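(* Let $0\le k\le n$, and let $\overline{\mathcal B}_l(n,k)$ be the quotient of $\mathcal B_l(n,k)$ by the ideal generated by $e_1(U_1,\dots,U_n),\dots,e_k(U_1,\dots,U_n)$. The algebra homomorphism $\Xi\colon\overline{\mathcal B}_l(n,k)\to\mathcal A^{\mathbb Z}_{n,k}$ induced by $\Xi\colon\mathcal B_l(n,k)\to\mathcal A^{\mathbb Z}_{n,k}$ is an isomorphism.
   Context: **Ozsváth–Szabó algebra.** Fix integers $n\ge 0$, $0\le k\le n$. An I-state is a subset $\mathbf x\subset\{0,\dots,n\}$; it is a left I-state if $n\notin\mathbf x$. $V(n,k)$ (resp. $V_l(n,k)$) is the set of I-states (resp. left I-states) with $k$ elements, $\mathbf x=\{x_1<\dots<x_k\}$. $\mathbf x,\mathbf y\in V(n,k)$ are too far if $|x_i-y_i|>1$ for some $i$. For $1\le i\le n$ put $v_i^{\mathbf x}=|\mathbf x\cap\{i,\dots,n\}|$. $\mathcal B_0(n,k)$ is the $\mathbb Z[U_1,\dots,U_n]$-algebra which is free as a module on elements $f_{\mathbf x,\mathbf y}$ ($\mathbf x,\mathbf y\in V(n,k)$), with $f_{\mathbf x,\mathbf y}f_{\mathbf y,\mathbf z}=\prod_{i=1}^nU_i^{g_i}f_{\mathbf x,\mathbf z}$, $g_i=\tfrac12(|v_i^{\mathbf y}-v_i^{\mathbf z}|-|v_i^{\mathbf x}-v_i^{\mathbf z}|+|v_i^{\mathbf x}-v_i^{\mathbf y}|)$, and $f_{\mathbf x,\mathbf y}f_{\mathbf w,\mathbf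 z}=0$ for $\mathbf y\ne\mathbf w$. The $\mathbf I_{\mathbf x}=f_{\mathbf x,\mathbf x}$ are orthogonal idempotents with sum $1$. For $1\le i\le n$, $R_i=\sum f_{\mathbf x,(\mathbf x\setminus\{i-1\})\cup\{i\}}$ over $\mathbf x$ with $\mathbf x\cap\{i-1,i\}=\{i-1\}$, and $L_i=\sum f_{\mathbf x,(\mathbf x\setminus\{i\})\cup\{i-1\}}$ over $\mathbf x$ with $\mathbf x\cap\{i-1,i\}=\{i\}$. $\mathcal B(n,k)$ is the quotient of $\mathcal B_0(n,k)$ by the two-sided ideal generated by $R_{i-1}R_i$, $L_iL_{i-1}$ ($2\le i\le n$) and $U_i\mathbf I_{\mathbf x}$ ($1\le i\le n$, $\mathbf x\cap\{i-1,i\}=\varnothing$). $\mathcal B_l(n,k)=e\,\mathcal B(n,k)\,e$ with $e=\sum_{\mathbf x\in V_l(n,k)}\mathbf I_{\mathbf x}$. **Integral Sartori algebra.** $R=\mathbb Z[x_1,\dots,x_n]$. $D_{n,k}$ is the set of sequences $\mu=\mu_1\cdots\mu_n$ of $k$ symbols $\wedge$ and $n-k$ symbols $\vee$; $\vee_j^\mu$ is the position of the $j$-th $\vee$. $b_i^\mu$ is $1$ plus the number of $\wedge$'s strictly to the right of position $i$. With $h_j$ complete homogeneous symmetric polynomials, $I_{\mathbf b}=\langle h_{b_1}(x_1),h_{b_2}(x_1,x_2),\dots,h_{b_n}(x_1,\dots,x_n)\rangle\subset R$, $R_{\mathbf b}=R/I_{\mathbf b}$. $\lambda,\mu\in D_{n,k}$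 are too far if for some $1\le j\le n-k-1$, $\vee_j^\mu\ge\vee_{j+1}^\lambda$ or $\vee_j^\lambda\ge\vee_{j+1}^\mu$. An $R$-map $R_{\mathbf b^\lambda}\to R_{\mathbf b^\mu}$ is written $(1\mapsto p)$. $\mathcal W^\alpha_{\lambda,\mu}\subset\mathrm{Hom}_R(R_{\mathbf b^\lambda},R_{\mathbf b^\mu})$ is the whole Hom space if $\lambda,\mu$ are too far, and otherwise the $R$-submodule generated by the maps $1\mapsto (x_{\alpha(j)}x_{\alpha(j)+1}\cdots x_{\beta(j)})(x_1^{c_1}\cdots x_n^{c_n})$, $1\le j\le n-k$, with $c_i=\max(b_i^\mu-b_i^\lambda,0)$, $\alpha(j)=\max(\vee_j^\lambda,\vee_j^\mu)$, $\beta(j)=\min(\vee_{j+1}^\mu,\vee_{j+1}^\lambda)-1$ for $j<n-k$, $\beta(n-k)=n$. Then $\mathcal A^{\mathbb Z}_{n,k}=\bigoplus_{\lambda,\mu\in D_{n,k}}\mathrm{Hom}_R(R_{\mathbf b^\lambda},R_{\mathbf b^\mu})/\mathcal W^\alpha_{\lambda,\mu}$ with product given by composition ($ab=a\circ b$). **The homomorphism.** $V_l(n,k)\leftrightarrow D_{n,k}$: $\mathbf x$ corresponds to the sequence with $\wedge$ exactly in positions $x_i+1$. Let $\mathbf x,\mathbf y$ correspond to $\mu,\lambda$. The $\mathbb Z[U_1,\dots,U_n]$-algebra homomorphism $\Xi\colon\mathcal B_l(n,k)\to\mathcal A^{\mathbb Z}_{n,k}$ ($U_i$ acting on $\mathcal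 A^{\mathbb Z}_{n,k}$ as $x_i$) sends $f_{\mathbf x,\mathbf y}$ to $0$ if $\mathbf x,\mathbf y$ are too far and otherwise to the class of $(1\mapsto\prod_ix_i^{c_i})\colon R_{\mathbf b^\lambda}\to R_{\mathbf b^\mu}$, $c_i=\max(v_i^{\mathbf x}-v_i^{\mathbf y},0)$. It is well defined and factors through $\overline{\mathcal B}_l(n,k)$. *)

(* Defs.v *)
From HB Require Import structures.
From mathcomp Require Import all_boot all_order all_algebra.
From mathcomp Require Import boolp functions.
From mathcomp Require Import mpoly.
From mathcomp Require Import zify.

Set Implicit Arguments.
Unset Strict Implicit.
Unset Printing Implicit Defensive.

Import GRing.Theory.
Local Open Scope ring_scope.
Local Open Scope quotient_scope.

(* An associative unital algebra over a commutative ring R, as a ring with a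
   central ring morphism [scalar] from R.  The library's [algType] requires
   1 != 0, which is not available a priori for an algebra given as a quotient. *)
HB.mixin Record isPzAlg (R : comPzRingType) A of GRing.PzRing A := {
  scalar : R -> A;
  scalar_zmod : zmod_morphism scalar;
  scalar_monoid : monoid_morphism scalar;
  scalar_central : forall c a, scalar c * a = a * scalar c
}.
#[short(type="pzAlgType")]
HB.structure Definition PzAlg (R : comPzRingType) :=
  {A of GRing.PzRing A & isPzAlg R A}.

HB.instance Definition _ (R : comPzRingType) (A : pzAlgType R) :=
  GRing.isZmodMorphism.Build R A (@scalar R A) scalar_zmod.
HB.instance Definition _ (R : comPzRingType) (A : pzAlgType R) :=
  GRing.isMonoidMorphism.Build R A (@scalar R A) scalar_monoid.

Definition alg_morphism (R : comPzRingType) (A B : pzAlgType R) (f : A -> B) :=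
  [/\ zmod_morphism f, monoid_morphism f & forall c : R, f (scalar c) = scalar c].

Section Submodules.
Variables (R : pzRingType) (M : lmodType R).

(* Ideals of a commutative ring R are submodules of R^o. *)
Record submod := Submod {
  submod_pred :> {pred M};
  submodP : submod_closed submod_pred }.

Definition in_submod_gen (S : M -> Prop) : {pred M} :=
  fun m => `[< forall N : submod, (forall s, S s -> s \in (N : {pred M})) ->
               m \in (N : {pred M}) >].

Lemma in_submod_gen_closed S : submod_closed (in_submod_gen S).
Proof.
split=> [|c u v /asboolP uS /asboolP vS]; apply/asboolP=> N SN.
  by case: (submodP N).
by case: (submodP N) => _; apply; [apply: uS | apply: vS].
Qed.

Definition submod_gen (S : M -> Prop) := Submod (in_submod_gen_closed S).

Definition submod_full := Submod (submod_pred := predT) (conj isT (fun _ _ _ _ _ => isT)).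

HB.instance Definition _ (N : submod) :=
  GRing.isSubmodClosed.Build R M (submod_pred N) (submodP N).

End Submodules.

Section QuotientModule.
Variables (R : pzRingType) (M : lmodType R) (N : submod M).

Definition mod_quot := Quotient.quot (submod_pred N).

HB.instance Definition _ := GRing.Zmodule.on mod_quot.

Definition mod_pi (m : M) : mod_quot := \pi_(Quotient.quot (submod_pred N)) m.
Definition mod_repr (q : mod_quot) : M := repr q.

Lemma mod_reprK : cancel mod_repr mod_pi.
Proof. exact: reprK. Qed.

Lemma mod_piE u v : (mod_pi u = mod_pi v) <-> (u - v \in (N : {pred M})).
Proof.
have -> : (u - v \in (N : {pred M})) = (mod_pi u == mod_pi v)
  by exact: Quotient.idealrBE.
by split=> /eqP.
Qed.

Lemma mod_piD u v : mod_pi (u + v) = mod_pi u + mod_pi v.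
Proof. by rewrite /mod_pi Quotient.pi_add. Qed.

Lemma mod_pi0 : mod_pi 0 = 0.
Proof. by apply: (addrI (mod_pi 0)); rewrite -mod_piD !addr0. Qed.

Definition mod_scale (c : R) (q : mod_quot) := mod_pi (c *: mod_repr q).

Lemma mod_piZ c u : mod_pi (c *: u) = mod_scale c (mod_pi u).
Proof.
apply/mod_piE; rewrite -scalerBr rpredZ //.
by apply/mod_piE; rewrite mod_reprK.
Qed.

Let scaleA a b q : mod_scale a (mod_scale b q) = mod_scale (a * b) q.
Proof. by rewrite -[q]mod_reprK -!mod_piZ scalerA. Qed.
Let scale1 : left_id 1 mod_scale.
Proof. by move=> q; rewrite -[q]mod_reprK -!mod_piZ scale1r. Qed.
Let scaleDr : right_distributive mod_scale +%R.
Proof.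
move=> c p q; rewrite -[p]mod_reprK -[q]mod_reprK -mod_piD -!mod_piZ -mod_piD.
by rewrite scalerDr.
Qed.
Let scaleDl q : {morph mod_scale^~ q : a b / a + b}.
Proof. by move=> a b; rewrite -[q]mod_reprK -!mod_piZ -mod_piD scalerDl. Qed.

HB.instance Definition _ := GRing.Zmodule_isLmodule.Build R mod_quot
  scaleA scale1 scaleDr scaleDl.

Lemma mod_pi_linear : linear mod_pi.
Proof. by move=> c u v; rewrite mod_piD mod_piZ. Qed.

End QuotientModule.

Section Ideals.
Variable A : pzRingType.

Definition ideal_closed (I : {pred A}) :=
  zmod_closed I /\ (forall a b, b \in I -> a * b \in I /\ b * a \in I).

Record ideal := Ideal { ideal_pred :> {pred A}; idealP : ideal_closed ideal_pred }.

Definition in_ideal_gen (S : A -> Prop) : {pred A} :=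
  fun a => `[< forall I : ideal, (forall s, S s -> s \in (I : {pred A})) ->
               a \in (I : {pred A}) >].

Lemma in_ideal_gen_closed S : ideal_closed (in_ideal_gen S).
Proof.
split; first split.
- by apply/asboolP=> I _; case: (idealP I) => [[]].
- move=> u v /asboolP uS /asboolP vS; apply/asboolP=> I SI.
  by case: (idealP I) => [[_ IZ] _]; apply: IZ; [apply: uS | apply: vS].
move=> a b /asboolP bS; split; apply/asboolP=> I SI.
  by case: (idealP I) => _ /(_ a b (bS I SI)) [].
by case: (idealP I) => _ /(_ a b (bS I SI)) [].
Qed.

Definition ideal_gen (S : A -> Prop) := Ideal (in_ideal_gen_closed S).

HB.instance Definition _ (I : ideal) :=
  GRing.isZmodClosed.Build A (ideal_pred I) (idealP I).1.

End Ideals.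

Section QuotientAlgebra.
Variables (R : comPzRingType) (A : pzAlgType R) (I : ideal A).

Definition alg_quot := Quotient.quot (ideal_pred I).

HB.instance Definition _ := GRing.Zmodule.on alg_quot.

Definition alg_pi (a : A) : alg_quot := \pi_(Quotient.quot (ideal_pred I)) a.

Lemma alg_reprK : cancel (fun q : alg_quot => repr q) alg_pi.
Proof. exact: reprK. Qed.

Lemma alg_piE a b : (alg_pi a = alg_pi b) <-> (a - b \in (I : {pred A})).
Proof.
have -> : (a - b \in (I : {pred A})) = (alg_pi a == alg_pi b)
  by exact: Quotient.idealrBE.
by split=> /eqP.
Qed.

Lemma alg_piD a b : alg_pi (a + b) = alg_pi a + alg_pi b.
Proof. by rewrite /alg_pi Quotient.pi_add. Qed.
Lemma alg_piN a : alg_pi (- a) = - alg_pi a.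
Proof. by rewrite /alg_pi Quotient.pi_opp. Qed.

Definition quot_mul (p q : alg_quot) : alg_quot := alg_pi (repr p * repr q).

Lemma alg_piM a b : alg_pi (a * b) = quot_mul (alg_pi a) (alg_pi b).
Proof.
apply/alg_piE; set a' := repr _; set b' := repr _.
have aa' : a - a' \in (I : {pred A}) by apply/alg_piE; rewrite alg_reprK.
have bb' : b - b' \in (I : {pred A}) by apply/alg_piE; rewrite alg_reprK.
have -> : a * b - a' * b' = (a - a') * b + a' * (b - b').
  by rewrite mulrBl mulrBr addrA subrK.
apply: rpredD; first by case: ((idealP I).2 b _ aa').
by case: ((idealP I).2 a' _ bb').
Qed.

Let ind (P : alg_quot -> Prop) : (forall a, P (alg_pi a)) -> forall q, P q.
Proof. by move=> h q; rewrite -[q]alg_reprK; apply: h. Qed.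

Let mulA : associative quot_mul.
Proof. by elim/ind=> a; elim/ind=> b; elim/ind=> c; rewrite -!alg_piM mulrA. Qed.
Let mul1 : left_id (alg_pi 1) quot_mul.
Proof. by elim/ind=> a; rewrite -!alg_piM mul1r. Qed.
Let mulr1' : right_id (alg_pi 1) quot_mul.
Proof. by elim/ind=> a; rewrite -!alg_piM mulr1. Qed.
Let mulDl : left_distributive quot_mul +%R.
Proof.
elim/ind=> a; elim/ind=> b; elim/ind=> c.
by rewrite -alg_piD -!alg_piM -alg_piD mulrDl.
Qed.
Let mulDr : right_distributive quot_mul +%R.
Proof.
elim/ind=> a; elim/ind=> b; elim/ind=> c.
by rewrite -alg_piD -!alg_piM -alg_piD mulrDr.
Qed.

HB.instance Definition _ := GRing.Zmodule_isPzRing.Build alg_quot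
  mulA mul1 mulr1' mulDl mulDr.

Definition quot_scalar (c : R) : alg_quot := alg_pi (scalar c).

Let scalZ : zmod_morphism quot_scalar.
Proof. by move=> c d; rewrite /quot_scalar rmorphB alg_piD alg_piN. Qed.
Let scalM : monoid_morphism quot_scalar.
Proof.
by split=> [|c d]; rewrite /quot_scalar ?rmorph1 // rmorphM alg_piM.
Qed.
Let scalC c a : quot_scalar c * a = a * quot_scalar c.
Proof.
elim/ind: a => a; rewrite /quot_scalar.
by rewrite [LHS]/GRing.mul [RHS]/GRing.mul /= -!alg_piM scalar_central.
Qed.
HB.instance Definition _ := isPzAlg.Build R alg_quot scalZ scalM scalC.

Lemma alg_pi_morphism : alg_morphism alg_pi.
Proof.
split=> //; first by move=> a b; rewrite alg_piD alg_piN.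
by split=> // a b; rewrite alg_piM.
Qed.

End QuotientAlgebra.

Record idempotent (A : pzRingType) :=
  Idempotent { idem : A; idemP : idem * idem = idem }.

Section Corner.
Variables (R : comPzRingType) (A : pzAlgType R) (e0 : idempotent A).
Local Notation e := (idem e0).

Definition in_corner : {pred A} := fun b => `[< exists a, b = e * a * e >].

Lemma in_corner_closed : zmod_closed in_corner.
Proof.
split; first by apply/asboolP; exists 0; rewrite mulr0 mul0r.
move=> _ _ /asboolP[a ->] /asboolP[b ->]; apply/asboolP.
by exists (a - b); rewrite mulrBr mulrBl.
Qed.
HB.instance Definition _ := GRing.isZmodClosed.Build A in_corner in_corner_closed.

Record corner := Corner { corner_val : A; cornerP : corner_val \in in_corner }.

HB.instance Definition _ := [isSub for corner_val].
HB.instance Definition _ := [Choice of corner by <:].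
HB.instance Definition _ := [SubChoice_isSubZmodule of corner by <:].

Lemma corner_idl (b : corner) : e * val b = val b.
Proof. by case: b => b /= /asboolP[a ->]; rewrite !mulrA idemP. Qed.
Lemma corner_idr (b : corner) : val b * e = val b.
Proof. by case: b => b /= /asboolP[a ->]; rewrite -!mulrA idemP. Qed.

Lemma in_cornerE b : e * b = b -> b * e = b -> b \in in_corner.
Proof. by move=> eb be; apply/asboolP; exists b; rewrite eb be. Qed.

Lemma corner_one_subproof : e \in in_corner.
Proof. by apply: in_cornerE; rewrite idemP. Qed.
Lemma corner_mul_subproof (a b : corner) : val a * val b \in in_corner.
Proof. by apply: in_cornerE; rewrite ?mulrA ?corner_idl // -mulrA corner_idr. Qed.
Lemma corner_scalar_subproof (c : R) : scalar c * e \in in_corner.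
Proof.
by apply: in_cornerE; rewrite ?mulrA -?scalar_central -!mulrA ?idemP.
Qed.

Definition corner_one := Corner corner_one_subproof.
Definition corner_mul a b := Corner (corner_mul_subproof a b).
Definition corner_scalar c := Corner (corner_scalar_subproof c).

Let mulA : associative corner_mul.
Proof. by move=> a b c; apply: val_inj => /=; rewrite mulrA. Qed.
Let mul1 : left_id corner_one corner_mul.
Proof. by move=> a; apply: val_inj; exact: corner_idl. Qed.
Let mulr1' : right_id corner_one corner_mul.
Proof. by move=> a; apply: val_inj; exact: corner_idr. Qed.
Let mulDl : left_distributive corner_mul +%R.
Proof. by move=> a b c; apply: val_inj; exact: mulrDl. Qed.
Let mulDr : right_distributive corner_mul +%R.
Proof. by move=> a b c; apply: val_inj; exact: mulrDr. Qed.
HB.instance Definition _ := GRing.Zmodule_isPzRing.Build corner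
  mulA mul1 mulr1' mulDl mulDr.

Let scalZ : zmod_morphism corner_scalar.
Proof. by move=> c d; apply: val_inj => /=; rewrite rmorphB mulrBl. Qed.
Let scalM : monoid_morphism corner_scalar.
Proof.
split=> [|c d]; apply: val_inj => /=; first by rewrite rmorph1 mul1r.
by rewrite rmorphM -!mulrA [_ * (scalar d * _)]mulrA -scalar_central -mulrA idemP.
Qed.
Let scalC c a : corner_scalar c * a = a * corner_scalar c.
Proof.
apply: val_inj => /=.
by rewrite -mulrA corner_idl mulrA -scalar_central -mulrA corner_idr.
Qed.
HB.instance Definition _ := isPzAlg.Build R corner scalZ scalM scalC.

End Corner.

Section LinearMaps.
Variables (R : comPzRingType) (M N : lmodType R).

Definition is_linear : {pred M -> N} := fun f => `[< linear f >].

Lemma is_linear_closed : submod_closed is_linear.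
Proof.
split; first by apply/asboolP=> c u v; rewrite /= scaler0 addr0.
move=> c f g /asboolP fl /asboolP gl; apply/asboolP=> d u v.
have E x : (c *: f + g) x = c *: f x + g x by [].
by rewrite !E fl gl !scalerDr !scalerA [c * d]mulrC addrACA.
Qed.
HB.instance Definition _ := GRing.isSubmodClosed.Build R (M -> N) is_linear
  is_linear_closed.

Record lin_hom := LinHom {
  lin_hom_val :> M -> N; lin_homP : lin_hom_val \in is_linear }.
HB.instance Definition _ := [isSub for lin_hom_val].
HB.instance Definition _ := [Choice of lin_hom by <:].
HB.instance Definition _ := [SubChoice_isSubLmodule of lin_hom by <:].

End LinearMaps.

Section Composition.
Variable R : comPzRingType.
Implicit Types M N : lmodType R.

Lemma lin_id_subproof M : (fun m : M => m) \in is_linear (N := M).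
Proof. by apply/asboolP. Qed.
Definition lin_id M := LinHom (lin_id_subproof M).

Lemma lin_comp_subproof M N (K : lmodType R) (g : lin_hom N K) (f : lin_hom M N) :
  (fun m => g (f m)) \in is_linear (M := M) (N := K).
Proof.
have /asboolP gl := lin_homP g; have /asboolP fl := lin_homP f.
by apply/asboolP => c u v /=; rewrite fl gl.
Qed.
Definition lin_comp M N (K : lmodType R) (g : lin_hom N K) (f : lin_hom M N) :=
  LinHom (lin_comp_subproof g f).

End Composition.

Notation zpoly n := {mpoly int[n]}.

Section States.
Variables n k : nat.

Definition V := {x : {set 'I_n.+1} | #|x| == k}.
Definition Vl := {x : V | ord_max \notin val x}.

(* x_1 < ... < x_k, indexed from 0 *)
Definition elt (x : V) (i : nat) : nat := nth 0 [seq val p | p <- enum (val x)] i.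

Definition too_far (x y : V) : bool :=
  [exists i : 'I_k, (1 < `|(elt x i)%:Z - (elt y i)%:Z|)%N].

Definition v (x : V) (i : nat) : nat := #|[set p in val x | (i <= p)%N]|.

Definition vdist (x y : V) (i : nat) : nat := `|(v x i)%:Z - (v y i)%:Z|%N.

(* The exponent g_i; [gdegE] shows that the truncated subtraction and the
   halving are exact. *)
Definition gdeg (x y z : V) (i : nat) : nat :=
  (vdist y z i + vdist x y i - vdist x z i)./2.

Lemma gdegE x y z i :
  ((gdeg x y z i).*2 + vdist x z i = vdist y z i + vdist x y i)%N.
Proof. by rewrite /gdeg /vdist; lia. Qed.

Lemma gdeg_cocycle x y z w i :
  (gdeg x y z i + gdeg x z w i = gdeg y z w i + gdeg x y w i)%N.
Proof.
have := (gdegE x y z i, gdegE x z w i, gdegE y z w i, gdegE x y w i).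
by case=> [[[]]]; lia.
Qed.

Lemma gdegxx x z i : gdeg x x z i = 0%N.
Proof. by have := gdegE x x z i; rewrite /vdist; lia. Qed.
Lemma gdegzz x z i : gdeg x z z i = 0%N.
Proof. by have := gdegE x z z i; rewrite /vdist; lia. Qed.

(* The ordinal i : 'I_n stands for the index i+1 of the variables U_1, ..., U_n. *)
Definition gmon (x y z : V) : zpoly n := \prod_(i < n) 'X_i ^+ gdeg x y z i.+1.

Lemma gmon_cocycle x y z w : gmon x y z * gmon x z w = gmon y z w * gmon x y w.
Proof.
rewrite -!big_split /=; apply: eq_bigr => i _.
by rewrite -!exprD gdeg_cocycle.
Qed.
Lemma gmonxx x z : gmon x x z = 1.
Proof. by apply: big1 => i _; rewrite gdegxx. Qed.
Lemma gmonzz x z : gmon x z z = 1.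
Proof. by apply: big1 => i _; rewrite gdegzz. Qed.

End States.

(* The free module on the f_{x,y}: an element is given by its coefficients. *)
Definition B0 (n k : nat) : Type := V n k -> V n k -> (zpoly n)^o.

Section B0.
Variables n k : nat.
Local Notation B0 := (B0 n k).
Local Notation V := (V n k).

HB.instance Definition _ := GRing.Lmodule.copy B0 (V -> V -> (zpoly n)^o).

Lemma B0_ext (a b : B0) : (forall x y, a x y = b x y) -> a = b.
Proof. by move=> ab; apply/funext=> x; apply/funext=> y; apply: ab. Qed.

Definition f (x y : V) : B0 := fun u w => ((u == x) && (w == y))%:R.

(* bilinear extension of f_{x,y} f_{y,z} = U^g f_{x,z} and f_{x,y} f_{w,z} = 0
   for y != w: see [f_mul] and [f_mul0] *)
Definition B0_mul (a b : B0) : B0 :=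
  fun x z => \sum_(y : V) gmon x y z * (a x y * b y z).

Definition B0_one : B0 := \sum_(x : V) f x x.

Lemma B0_oneE x y : B0_one x y = (x == y)%:R.
Proof.
rewrite /B0_one !fct_sumE (bigD1 x) //= big1 ?addr0 => [|z zx].
  by rewrite /f eqxx eq_sym.
by rewrite /f eq_sym (negPf zx).
Qed.

Let B0_mulA_aux (K : comPzRingType) (g1 g2 g3 g4 a b c : K) :
  g4 * g3 = g2 * g1 -> g1 * (a * (g2 * (b * c))) = g3 * (g4 * (a * b) * c).
Proof.
move=> h; rewrite -!mulrA (mulrCA a g2) [LHS]mulrA [RHS]mulrA.
by rewrite (mulrC g1 g2) -h (mulrC g4).
Qed.

Let mulA : associative B0_mul.
Proof.
move=> a b c; apply: B0_ext => x w; rewrite /B0_mul.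
under eq_bigr => y _ do rewrite mulr_sumr mulr_sumr.
under [RHS]eq_bigr => y _ do rewrite mulr_suml mulr_sumr.
rewrite exchange_big /=; apply: eq_bigr => z _; apply: eq_bigr => y _.
by apply: B0_mulA_aux; apply: gmon_cocycle.
Qed.
Let mul1 : left_id B0_one B0_mul.
Proof.
move=> a; apply: B0_ext => x y; rewrite /B0_mul.
rewrite (bigD1 x) //= B0_oneE eqxx gmonxx !mul1r big1 ?addr0 // => z zx.
by rewrite B0_oneE eq_sym (negPf zx) mul0r mulr0.
Qed.
Let mulr1' : right_id B0_one B0_mul.
Proof.
move=> a; apply: B0_ext => x y; rewrite /B0_mul.
rewrite (bigD1 y) //= B0_oneE eqxx gmonzz mul1r mulr1 big1 ?addr0 // => z zx.
by rewrite B0_oneE (negPf zx) !mulr0.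
Qed.
Let mulDl : left_distributive B0_mul +%R.
Proof.
move=> a b c; apply: B0_ext => x z; rewrite -[RHS]big_split /=.
by apply: eq_bigr => y _; rewrite -mulrDr -mulrDl.
Qed.
Let mulDr : right_distributive B0_mul +%R.
Proof.
move=> a b c; apply: B0_ext => x z; rewrite -[RHS]big_split /=.
by apply: eq_bigr => y _; rewrite -!mulrDr.
Qed.
HB.instance Definition _ := GRing.Zmodule_isPzRing.Build B0
  mulA mul1 mulr1' mulDl mulDr.

Definition B0_scalar (c : zpoly n) : B0 := c *: B0_one.

Lemma B0_mulE (a b : B0) x z :
  (a * b) x z = \sum_(y : V) gmon x y z * (a x y * b y z).
Proof. by []. Qed.

Lemma B0_scaleE c (a : B0) x y : (c *: a) x y = c * a x y.
Proof. by []. Qed.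

Lemma B0_scalarE c x y : B0_scalar c x y = c * B0_one x y.
Proof. by []. Qed.

Lemma B0_scalarl c (a : B0) : B0_scalar c * a = c *: a.
Proof.
rewrite -[in RHS](mul1 a); apply: B0_ext => x z.
rewrite B0_scaleE /B0_mul mulr_sumr; apply: eq_bigr => y _.
rewrite B0_scalarE -[_ * _ * a y z]mulrA.
by rewrite [LHS]mulrCA.
Qed.
Lemma B0_scalarr c (a : B0) : a * B0_scalar c = c *: a.
Proof.
rewrite -[in RHS](mulr1' a); apply: B0_ext => x z.
rewrite B0_scaleE /B0_mul mulr_sumr; apply: eq_bigr => y _.
by rewrite B0_scalarE [a x y * _]mulrCA [LHS]mulrCA.
Qed.

Let scalZ : zmod_morphism B0_scalar.
Proof. by move=> c d; rewrite /B0_scalar scalerBl. Qed.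
Let scalM : monoid_morphism B0_scalar.
Proof.
split=> [|c d]; first by rewrite /B0_scalar scale1r.
by rewrite B0_scalarl scalerA.
Qed.
Let scalC c a : B0_scalar c * a = a * B0_scalar c.
Proof. by rewrite B0_scalarl B0_scalarr. Qed.
HB.instance Definition _ := isPzAlg.Build (zpoly n) B0 scalZ scalM scalC.

Lemma f_mul x y z : f x y * f y z = gmon x y z *: f x z.
Proof.
apply: B0_ext => u w; rewrite B0_mulE B0_scaleE (bigD1 y) //= big1 => [|v vy].
  rewrite addr0 /f eqxx andbT /=.
  case: (u =P x) => [->|_]; last by rewrite mul0r !mulr0.
  by case: (w =P z) => [->|_]; rewrite ?mul1r ?mulr0.
by rewrite /f (negPf vy) andbF mul0r mulr0.
Qed.

Lemma f_mul0 x y w z : y != w -> f x y * f w z = 0.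
Proof.
move=> yw; apply: B0_ext => u t; rewrite B0_mulE big1 // => v _.
rewrite /f; case: (v =P y) => [->|_]; last by rewrite andbF mul0r mulr0.
by rewrite (negPf yw) !mulr0.
Qed.

(* For i : 'I_n standing for the index i+1, these are i and i+1 as elements of
   {0, ..., n}. *)
Definition lo (i : 'I_n) : 'I_n.+1 := widen_ord (leqnSn n) i.
Definition hi (i : 'I_n) : 'I_n.+1 := lift ord0 i.

Definition Rgen (i : 'I_n) : B0 :=
  \sum_(p : V * V | (val p.1 :&: [set lo i; hi i] == [set lo i]) &&
                    (val p.2 == (val p.1 :\ lo i) :|: [set hi i])) f p.1 p.2.

Definition Lgen (i : 'I_n) : B0 :=
  \sum_(p : V * V | (val p.1 :&: [set lo i; hi i] == [set hi i]) &&
                    (val p.2 == (val p.1 :\ hi i) :|: [set lo i])) f p.1 p.2.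

Inductive B_rel : B0 -> Prop :=
| B_rel_RR (i j : 'I_n) : val j = (val i).+1 -> B_rel (Rgen i * Rgen j)
| B_rel_LL (i j : 'I_n) : val j = (val i).+1 -> B_rel (Lgen j * Lgen i)
| B_rel_U (i : 'I_n) (x : V) :
    val x :&: [set lo i; hi i] = set0 -> B_rel ('X_i *: f x x).

Definition B := alg_quot (ideal_gen B_rel).
HB.instance Definition _ := PzAlg.on B.

Definition fB (x y : V) : B := alg_pi (ideal_gen B_rel) (f x y).

End B0.

Section Bl.
Variables n k : nat.
Local Notation V := (V n k).
Local Notation Vl := (Vl n k).

Definition left_sum : B n k := \sum_(x : V | ord_max \notin val x) fB x x.

Lemma fB_idl (x y : V) : fB x x * fB x y = fB x y.
Proof.
have [_ [_ piM] _] := alg_pi_morphism (ideal_gen (@B_rel n k)).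
by rewrite /fB -piM f_mul gmonxx scale1r.
Qed.
Lemma fB_idr (x y : V) : fB x y * fB y y = fB x y.
Proof.
have [_ [_ piM] _] := alg_pi_morphism (ideal_gen (@B_rel n k)).
by rewrite /fB -piM f_mul gmonzz scale1r.
Qed.
Lemma fB_mul0 (x y w z : V) : y != w -> fB x y * fB w z = 0.
Proof.
have [piB [_ piM] _] := alg_pi_morphism (ideal_gen (@B_rel n k)).
move=> yw; rewrite /fB -piM f_mul0 //.
by have := piB 0 0; rewrite !subrr.
Qed.

Lemma left_suml (x y : V) : ord_max \notin val x -> left_sum * fB x y = fB x y.
Proof.
move=> xl; rewrite /left_sum mulr_suml (bigD1 x) //= fB_idl.
by rewrite big1 ?addr0 // => z /andP[_ zx]; rewrite fB_mul0.
Qed.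
Lemma left_sumr (x y : V) : ord_max \notin val y -> fB x y * left_sum = fB x y.
Proof.
move=> yl; rewrite /left_sum mulr_sumr (bigD1 y) //= fB_idr.
by rewrite big1 ?addr0 // => z /andP[_ zy]; rewrite fB_mul0 // eq_sym.
Qed.

Lemma left_sum_idem : left_sum * left_sum = left_sum.
Proof.
rewrite {2 3}/left_sum mulr_sumr; apply: eq_bigr => x xl.
by rewrite left_suml.
Qed.
Definition left_idem := Idempotent left_sum_idem.

Definition Bl := corner left_idem.
HB.instance Definition _ := PzAlg.on Bl.

Lemma fl_subproof (x y : Vl) : fB (val x) (val y) \in in_corner left_idem.
Proof.
by apply: in_cornerE; [apply: left_suml; case: x | apply: left_sumr; case: y].
Qed.
Definition fl (x y : Vl) : Bl := Corner (fl_subproof x y).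

Inductive Bl_rel : Bl -> Prop :=
| Bl_rel_sym (j : nat) : (0 < j <= k)%N -> Bl_rel (scalar (mesym n int j)).

(* B_l modulo the ideal generated by e_1(U), ..., e_k(U) *)
Definition Bbar := alg_quot (ideal_gen Bl_rel).
HB.instance Definition _ := PzAlg.on Bbar.

Definition Bbar_pi (b : Bl) : Bbar := alg_pi (ideal_gen Bl_rel) b.

End Bl.

Section Sequences.
Variables n k : nat.

(* [true] is a wedge and [false] a vee *)
Definition D := {mu : n.-tuple bool | count id mu == k}.

Definition vees (mu : D) : seq nat :=
  [seq i.+1 | i <- iota 0 n & ~~ nth false (val mu) i].

(* position of the j-th vee; positions and j are counted from 1 *)
Definition vee (mu : D) (j : nat) : nat := nth 0 (vees mu) j.-1.

(* b_i, for i counted from 1 *)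
Definition bseq (mu : D) (i : nat) : nat := (count id (drop i (val mu))).+1.

Definition seq_too_far (lam mu : D) : bool :=
  [exists j : 'I_n, (0 < j < n - k)%N &&
    ((vee lam j.+1 <= vee mu j) || (vee mu j.+1 <= vee lam j))%N].

(* complete homogeneous symmetric polynomial of degree d in x_1, ..., x_i *)
Definition hsym (d i : nat) : zpoly n :=
  \sum_(m : 'X_{1..n < d.+1} |
        (mdeg m == d) && [forall j : 'I_n, (i <= j)%N ==> (val m j == 0%N)]) 'X_[m].

Definition Ib (mu : D) : submod (zpoly n)^o :=
  @submod_gen (zpoly n) (zpoly n)^o
    (fun p => exists i : 'I_n, p = hsym (bseq mu i.+1) i.+1).

Definition Rb (mu : D) := mod_quot (Ib mu).
HB.instance Definition _ mu := GRing.Lmodule.on (Rb mu).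

Definition Rb_pi (mu : D) (p : zpoly n) : Rb mu := mod_pi (Ib mu) p.

Definition hom (lam mu : D) := lin_hom (Rb lam) (Rb mu).
HB.instance Definition _ lam mu := GRing.Lmodule.on (hom lam mu).

(* phi is the map (1 |-> p); such a map is unique, when it exists *)
Definition is_map1 (lam mu : D) (p : zpoly n) (phi : hom lam mu) : Prop :=
  phi (Rb_pi lam 1) = Rb_pi mu p.

Definition alpha (lam mu : D) (j : nat) : nat := maxn (vee lam j) (vee mu j).

Definition beta (lam mu : D) (j : nat) : nat :=
  if (j < n - k)%N then (minn (vee mu j.+1) (vee lam j.+1)).-1 else n.

Definition W_mon (lam mu : D) (j : nat) : zpoly n :=
  (\prod_(i < n | (alpha lam mu j <= i.+1 <= beta lam mu j)%N) 'X_i) *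
  (\prod_(i < n) 'X_i ^+ (bseq mu i.+1 - bseq lam i.+1)).

Definition W (lam mu : D) : submod (hom lam mu) :=
  if seq_too_far lam mu then submod_full (hom lam mu)
  else submod_gen (fun phi =>
    exists2 j : nat, (0 < j <= n - k)%N & is_map1 (W_mon lam mu j) phi).

(* The condition for composition to descend to the quotients by the W's. *)
Definition W_ideal : Prop :=
  forall (lam mu nu : D) (g : hom mu nu) (h : hom lam mu),
    g \in (W mu nu : {pred _}) \/ h \in (W lam mu : {pred _}) ->
    lin_comp g h \in (W lam nu : {pred _}).

Definition qhom (lam mu : D) := mod_quot (W lam mu).
HB.instance Definition _ lam mu := GRing.Lmodule.on (qhom lam mu).
Definition qhom_pi lam mu (h : hom lam mu) : qhom lam mu := mod_pi (W lam mu) h.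

Definition qcomp (lam mu nu : D) (q : qhom mu nu) (r : qhom lam mu) :
  qhom lam nu := qhom_pi (lin_comp (mod_repr q) (mod_repr r)).

Definition qid (lam mu : D) : qhom lam mu :=
  if lam =P mu is ReflectT e
  then eq_rect lam (qhom lam) (qhom_pi (lin_id (Rb lam))) mu e else 0.

(* The direct sum of the quotients, as a ring with product (ab)(lam, nu) =
   sum over mu of a(mu, nu) o b(lam, mu).  The proof of [W_ideal] is what makes
   the product independent of representatives, see [qcomp_pi]. *)
Definition sartori (W_id : W_ideal) : Type := forall lam mu : D, qhom lam mu.

Section Algebra.
Variable W_id : W_ideal.
Local Notation A := (sartori W_id).

Lemma lin_compDl (lam mu nu : D) (g g' : hom mu nu) (h : hom lam mu) :
  lin_comp (g + g') h = lin_comp g h + lin_comp g' h.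
Proof. by apply: val_inj. Qed.
Lemma lin_compDr (lam mu nu : D) (g : hom mu nu) (h h' : hom lam mu) :
  lin_comp g (h + h') = lin_comp g h + lin_comp g h'.
Proof.
apply: val_inj; apply/funext => u /=; have /asboolP gl := lin_homP g.
by have := gl 1 (h u) (h' u); rewrite !scale1r.
Qed.
Lemma lin_compZl c (lam mu nu : D) (g : hom mu nu) (h : hom lam mu) :
  lin_comp (c *: g) h = c *: lin_comp g h.
Proof. by apply: val_inj. Qed.
Lemma lin_compZr c (lam mu nu : D) (g : hom mu nu) (h : hom lam mu) :
  lin_comp g (c *: h) = c *: lin_comp g h.
Proof.
apply: val_inj; apply/funext => u /=; have /asboolP gl := lin_homP g.
have g0 : g 0 = 0 by apply: (addrI (g 0)); have := gl 1 0 0; rewrite !scale1r !addr0.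
by have := gl c (h u) 0; rewrite g0 !addr0.
Qed.

Lemma lin_compBl (lam mu nu : D) (g g' : hom mu nu) (h : hom lam mu) :
  lin_comp (g - g') h = lin_comp g h - lin_comp g' h.
Proof. by apply: val_inj. Qed.
Lemma lin_compBr (lam mu nu : D) (g : hom mu nu) (h h' : hom lam mu) :
  lin_comp g (h - h') = lin_comp g h - lin_comp g h'.
Proof.
by rewrite lin_compDr; congr (_ + _); rewrite -[RHS]scaleN1r -lin_compZr scaleN1r.
Qed.

Lemma qcomp_pi (lam mu nu : D) (g : hom mu nu) (h : hom lam mu) :
  qcomp (qhom_pi g) (qhom_pi h) = qhom_pi (lin_comp g h).
Proof.
rewrite /qcomp; set g' := mod_repr _; set h' := mod_repr _.
have gg' : g' - g \in (W mu nu : {pred _}) by apply/mod_piE; rewrite mod_reprK.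
have hh' : h' - h \in (W lam mu : {pred _}) by apply/mod_piE; rewrite mod_reprK.
apply/mod_piE.
have -> : lin_comp g' h' - lin_comp g h = lin_comp (g' - g) h' + lin_comp g (h' - h).
  by rewrite lin_compBl lin_compBr addrA subrK.
by rewrite rpredD //; apply: W_id; [left | right].
Qed.

Lemma qhom_ind (lam mu : D) (P : qhom lam mu -> Prop) :
  (forall h, P (qhom_pi h)) -> forall q, P q.
Proof. by move=> h q; rewrite -[q]mod_reprK; apply: h. Qed.

Lemma qcompA (lam mu nu ka : D) (p : qhom nu ka) (q : qhom mu nu) (r : qhom lam mu) :
  qcomp p (qcomp q r) = qcomp (qcomp p q) r.
Proof.
elim/qhom_ind: p => p; elim/qhom_ind: q => q; elim/qhom_ind: r => r.
by rewrite !qcomp_pi; congr qhom_pi; apply: val_inj.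
Qed.
Lemma qcompDl (lam mu nu : D) (p q : qhom mu nu) (r : qhom lam mu) :
  qcomp (p + q) r = qcomp p r + qcomp q r.
Proof.
elim/qhom_ind: p => p; elim/qhom_ind: q => q; elim/qhom_ind: r => r.
by rewrite -mod_piD !qcomp_pi -mod_piD lin_compDl.
Qed.
Lemma qcompDr (lam mu nu : D) (p : qhom mu nu) (q r : qhom lam mu) :
  qcomp p (q + r) = qcomp p q + qcomp p r.
Proof.
elim/qhom_ind: p => p; elim/qhom_ind: q => q; elim/qhom_ind: r => r.
by rewrite -mod_piD !qcomp_pi -mod_piD lin_compDr.
Qed.
Lemma qcompZl c (lam mu nu : D) (p : qhom mu nu) (q : qhom lam mu) :
  qcomp (c *: p) q = c *: qcomp p q.
Proof.
elim/qhom_ind: p => p; elim/qhom_ind: q => q.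
have piZ l m (h : hom l m) : c *: qhom_pi h = qhom_pi (c *: h) by rewrite /qhom_pi mod_piZ.
by rewrite piZ !qcomp_pi piZ lin_compZl.
Qed.
Lemma qcompZr c (lam mu nu : D) (p : qhom mu nu) (q : qhom lam mu) :
  qcomp p (c *: q) = c *: qcomp p q.
Proof.
elim/qhom_ind: p => p; elim/qhom_ind: q => q.
have piZ l m (h : hom l m) : c *: qhom_pi h = qhom_pi (c *: h) by rewrite /qhom_pi mod_piZ.
by rewrite piZ !qcomp_pi piZ lin_compZr.
Qed.
Lemma qcomp0l (lam mu nu : D) (q : qhom lam mu) : qcomp (0 : qhom mu nu) q = 0.
Proof. by rewrite -[X in qcomp X](scale0r 0) qcompZl scale0r. Qed.
Lemma qcomp0r (lam mu nu : D) (q : qhom mu nu) : qcomp q (0 : qhom lam mu) = 0.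
Proof. by rewrite -[X in qcomp _ X](scale0r 0) qcompZr scale0r. Qed.

Lemma qcomp_idl (lam mu : D) (q : qhom lam mu) : qcomp (qid mu mu) q = q.
Proof.
rewrite /qid; case: eqP => // e; rewrite (eq_irrelevance e erefl) /=.
by elim/qhom_ind: q => q; rewrite qcomp_pi; congr qhom_pi; apply: val_inj.
Qed.
Lemma qcomp_idr (lam mu : D) (q : qhom lam mu) : qcomp q (qid lam lam) = q.
Proof.
rewrite /qid; case: eqP => // e; rewrite (eq_irrelevance e erefl) /=.
by elim/qhom_ind: q => q; rewrite qcomp_pi; congr qhom_pi; apply: val_inj.
Qed.
Lemma qid0 (lam mu : D) : lam != mu -> qid lam mu = 0.
Proof. by rewrite /qid; case: eqP. Qed.

Lemma sartori_ext (a b : A) : (forall lam mu, a lam mu = b lam mu) -> a = b.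
Proof.
by move=> ab; apply: functional_extensionality_dep => lam;
  apply: functional_extensionality_dep => mu.
Qed.

Definition s_zero : A := fun lam mu => 0.
Definition s_opp (a : A) : A := fun lam mu => - a lam mu.
Definition s_add (a b : A) : A := fun lam mu => a lam mu + b lam mu.
Definition s_one : A := qid.
Definition s_mul (a b : A) : A :=
  fun lam nu => \sum_(mu : D) qcomp (a mu nu) (b lam mu).
Definition s_scalar (c : zpoly n) : A := fun lam mu => c *: qid lam mu.

HB.instance Definition _ := gen_eqMixin A.
HB.instance Definition _ := gen_choiceMixin A.

Let addA : associative s_add.
Proof. by move=> a b c; apply: sartori_ext => l m; exact: addrA. Qed.
Let addC : commutative s_add.
Proof. by move=> a b; apply: sartori_ext => l m; exact: addrC. Qed.
Let add0 : left_id s_zero s_add.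
Proof. by move=> a; apply: sartori_ext => l m; exact: add0r. Qed.
Let addN : left_inverse s_zero s_opp s_add.
Proof. by move=> a; apply: sartori_ext => l m; exact: addNr. Qed.
HB.instance Definition _ := GRing.isZmodule.Build A addA addC add0 addN.

Lemma qcomp_suml (I : finType) (lam mu nu : D) (F : I -> qhom mu nu) (q : qhom lam mu) :
  qcomp (\sum_i F i) q = \sum_i qcomp (F i) q.
Proof.
by apply: (big_morph (fun x => qcomp x q)) => [x y|]; rewrite ?qcompDl ?qcomp0l.
Qed.
Lemma qcomp_sumr (I : finType) (lam mu nu : D) (q : qhom mu nu) (F : I -> qhom lam mu) :
  qcomp q (\sum_i F i) = \sum_i qcomp q (F i).
Proof.
by apply: (big_morph (fun x => qcomp q x)) => [x y|]; rewrite ?qcompDr ?qcomp0r.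
Qed.

Let mulA : associative s_mul.
Proof.
move=> a b c; apply: sartori_ext => l m; rewrite /s_mul.
under eq_bigr => x _ do rewrite qcomp_sumr.
under [RHS]eq_bigr => x _ do rewrite qcomp_suml.
rewrite exchange_big /=; apply: eq_bigr => x _; apply: eq_bigr => y _.
by rewrite qcompA.
Qed.
Let mul1 : left_id s_one s_mul.
Proof.
move=> a; apply: sartori_ext => l m; rewrite /s_mul (bigD1 m) //= qcomp_idl.
by rewrite big1 ?addr0 // => x xm; rewrite /s_one qid0 // qcomp0l.
Qed.
Let mulr1' : right_id s_one s_mul.
Proof.
move=> a; apply: sartori_ext => l m; rewrite /s_mul (bigD1 l) //= qcomp_idr.
by rewrite big1 ?addr0 // => x xl; rewrite /s_one qid0 1?eq_sym // qcomp0r.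
Qed.
Let mulDl : left_distributive s_mul +%R.
Proof.
move=> a b c; apply: sartori_ext => l m; rewrite -[RHS]big_split /=.
by apply: eq_bigr => x _; rewrite -qcompDl.
Qed.
Let mulDr : right_distributive s_mul +%R.
Proof.
move=> a b c; apply: sartori_ext => l m; rewrite -[RHS]big_split /=.
by apply: eq_bigr => x _; rewrite -qcompDr.
Qed.
HB.instance Definition _ := GRing.Zmodule_isPzRing.Build A
  mulA mul1 mulr1' mulDl mulDr.

Lemma s_scalarl c (a : A) lam mu : (s_scalar c * a) lam mu = c *: a lam mu.
Proof.
rewrite -[in RHS](mul1 a) /s_mul scaler_sumr; apply: eq_bigr => x _.
by rewrite /s_scalar qcompZl.
Qed.
Lemma s_scalarr c (a : A) lam mu : (a * s_scalar c) lam mu = c *: a lam mu.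
Proof.
rewrite -[in RHS](mulr1' a) /s_mul scaler_sumr; apply: eq_bigr => x _.
by rewrite /s_scalar qcompZr.
Qed.
Let scalZ : zmod_morphism s_scalar.
Proof. by move=> c d; apply: sartori_ext => l m; rewrite /s_scalar scalerBl. Qed.
Let scalM : monoid_morphism s_scalar.
Proof.
split=> [|c d]; apply: sartori_ext => l m; first by rewrite /s_scalar scale1r.
by rewrite s_scalarl /s_scalar scalerA.
Qed.
Let scalC c a : s_scalar c * a = a * s_scalar c.
Proof. by apply: sartori_ext => l m; rewrite s_scalarl s_scalarr. Qed.
HB.instance Definition _ := isPzAlg.Build (zpoly n) A scalZ scalM scalC.

End Algebra.
End Sequences.

Section Xi.
Variables n k : nat.

(* wedges in the positions x_i + 1 *)
Definition wedges (x : Vl n k) : n.-tuple bool :=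
  [tuple widen_ord (leqnSn n) i \in val (val x) | i < n].

Lemma wedgesP (x : Vl n k) : count id (wedges x) == k.
Proof.
case: x => -[x /= /eqP xk] /= xl; rewrite -xk /= count_map.
have xE : x = [set widen_ord (leqnSn n) i | i in
                [set i : 'I_n | widen_ord (leqnSn n) i \in x]].
  apply/setP=> p; apply/idP/imsetP => [px|[i]]; last by rewrite inE => ? ->.
  have pn : (p < n)%N.
    rewrite ltn_neqAle -ltnS ltn_ord andbT; apply: contra xl => /eqP pn.
    by rewrite (_ : ord_max = p) //; apply: val_inj.
  have pE : p = widen_ord (leqnSn n) (Ordinal pn) by apply: val_inj.
  by exists (Ordinal pn); rewrite // inE -pE.
have -> : #|x| = #|[set i : 'I_n | widen_ord (leqnSn n) i \in x]|.
  by rewrite {1}xE card_imset // => i j /(congr1 val) /= ?; apply: val_inj.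
rewrite cardsE -sum1_card -sum1_count big_enum_cond /=.
by apply/eqP; apply: eq_bigl => i; rewrite unfold_in.
Qed.

Definition seq_of_state (x : Vl n k) : D n k :=
  exist (fun mu : n.-tuple bool => count id mu == k) (wedges x) (wedgesP x).

Definition Xi_mon (x y : V n k) : zpoly n :=
  \prod_(i < n) 'X_i ^+ (v x i.+1 - v y i.+1).

(* The value of Xi on f_{x,y}: zero if x and y are too far, and otherwise the
   class of (1 |-> x^c) in the summand indexed by (lambda, mu). *)
Definition Xi_spec (W_id : W_ideal n k) (Xi : Bl n k -> sartori W_id) : Prop :=
  forall x y : Vl n k, let mu := seq_of_state x in let lam := seq_of_state y in
  if too_far (val x) (val y) then Xi (fl x y) = 0
  else exists2 phi : hom lam mu, is_map1 (Xi_mon (val x) (val y)) phi &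
    Xi (fl x y) lam mu = qhom_pi phi /\
    (forall lam' mu', (lam', mu') != (lam, mu) -> Xi (fl x y) lam' mu' = 0).

End Xi.

(* Main.v *)
Require Import Defs.
From HB Require Import structures.
From mathcomp Require Import all_boot all_order all_algebra.
From mathcomp Require Import boolp functions.
From mathcomp Require Import mpoly.
From mathcomp Require Import zify ring.

Set Implicit Arguments.
Unset Strict Implicit.
Unset Printing Implicit Defensive.

Import GRing.Theory.
Local Open Scope ring_scope.

(** For a state [x] let [gaps x a] be the number of sites below [a] that [x]
    leaves empty. As a function of [a] this is a lattice path with steps 0 and
    1, from 0 at 0 to [n + 1 - k] at [n + 1], and every exponent occurring in
    the two algebras is read off from it, since [v x a + a = gaps x a + k].

    Over the polynomial ring, the summand of the quotient of [Bl] indexed by a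
    pair of left states [x], [y] is generated by [f_{x,y}], and the matching
    summand of the Sartori algebra is generated by the class of [1 |-> x^c]. The
    products of generators involve the same monomial [gmon], so that the theorem
    amounts to the equality of the annihilators of the two generators. Both are
    equal to the ideal [hom_ideal x y], which is generated by the elementary
    symmetric polynomials [e_1, ..., e_k] and, for each height [h] with
    [0 < h <= n - k], by the product [level_mon x y h] of the variables over the
    positions where the paths of [x] and [y] are both at height [h]. For states
    that are too far apart, one of these products is empty, hence equal to 1.

    On the side of the Ozsvath-Szabo algebra, the families of ideals spanned by
    the [level_mon] are stable under the product and contain the coefficients of
    the defining relations ([rel_ideal_level]). Conversely [level_mon x y h] kills
    [f_{x,y}] because this element factors through a state whose path crosses
    height [h] at a single position, or, if the two paths never meet at that
    height, through two states that differ by a particle moving by two sites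
    ([level_mon_relation]).

    On the side of the Sartori algebra, write [I_F] for the ideal of a lattice
    path [F], generated by the [h_{F(i)+1}(x_1, ..., x_i)]. When [G] is below
    [F], the ideal quotient [I_F : I_G] is generated by [x^(F-G)] modulo [I_F],
    and [I_F : x^(F-G)] is [I_G] ([path_colon]). Removing one box at a time
    reduces this to the fact that [x_i] and [h_{F(i)}(x_1, ..., x_i)] are not zero
    divisors modulo the generators of index other than [i], which are monic in
    successive variables ([nzd_path_gens]). With [F] the path [v x] and [G] the
    pointwise minimum of [v x] and [v y], the first statement shows that every homomorphism is a multiple of [1 |-> x^c], and the
    second that the annihilator of this map is [I_G]. Finally, modulo the
    symmetric polynomials of positive degree,
    [h_d(x_1, ..., x_i) = (-1)^d e_d(x_(i+1), ..., x_n)], and by the pigeonhole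
    principle each square-free monomial of [e_d(x_(i+1), ..., x_n)] with
    [d > G(i)] is a multiple of some [level_mon x y h]; hence [I_G] is contained
    in [hom_ideal x y] ([path_min_hom_ideal]). *)

(** * Ideals given by generators *)

Section GeneratedIdeals.
Variable R : comPzRingType.
Implicit Types (S T Q : R -> Prop) (p q : R).

(** Ideals are handled as predicates on [R] itself, whereas submodules of the
    regular module live on the alias [R^o]. *)
Definition in_gen S p : Prop := p \in (@submod_gen R R^o S : {pred R^o}).

Lemma gen_mem S s : S s -> in_gen S s.
Proof. by move=> Ss; apply/asboolP=> N; apply. Qed.

Lemma gen0 S : in_gen S 0.
Proof. exact: (submodP (@submod_gen R R^o S)).1. Qed.

Lemma genD S p q : in_gen S p -> in_gen S q -> in_gen S (p + q).
Proof. exact: (@rpredD R^o (@submod_gen R R^o S)). Qed.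

Lemma genM S c p : in_gen S p -> in_gen S (c * p).
Proof. by move=> pS; apply: (@rpredZ R R^o (@submod_gen R R^o S) c p). Qed.

Lemma genMr S c p : in_gen S p -> in_gen S (p * c).
Proof. by rewrite mulrC; apply: genM. Qed.

Lemma genN S p : in_gen S p -> in_gen S (- p).
Proof. by rewrite -mulN1r; apply: genM. Qed.

Lemma genB S p q : in_gen S p -> in_gen S q -> in_gen S (p - q).
Proof. by move=> pS qS; apply: genD => //; apply: genN. Qed.

Lemma gen_sum S (I : Type) (r : seq I) (P : pred I) (F : I -> R) :
  (forall i, P i -> in_gen S (F i)) -> in_gen S (\sum_(i <- r | P i) F i).
Proof. by move=> FS; elim/big_ind: _ => //; [apply: gen0 | apply: genD]. Qed.

Definition ideal_pred_closed Q :=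
  [/\ Q 0, (forall p q, Q p -> Q q -> Q (p + q)) & (forall c p, Q p -> Q (c * p))].

(** All inclusions between ideals are proved in this way. *)
Lemma gen_ind S Q : ideal_pred_closed Q -> (forall s, S s -> Q s) ->
  forall p, in_gen S p -> Q p.
Proof.
move=> [Q0 QD QM] QS p /asboolP pS.
have cl : @submod_closed R R^o (fun u => `[<Q u>]).
  split=> [|c u w /asboolP Qu /asboolP Qw]; apply/asboolP => //.
  by apply: QD => //; apply: QM.
apply/asboolP; apply: (pS (Submod cl)) => s Ss.
by apply/asboolP; apply: QS.
Qed.

Lemma in_gen_closed S : ideal_pred_closed (in_gen S).
Proof. by split; [apply: gen0 | apply: genD | apply: genM]. Qed.

Lemma gen_sub S T : (forall s, S s -> in_gen T s) ->
  forall p, in_gen S p -> in_gen T p.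
Proof. exact: (gen_ind (in_gen_closed T)). Qed.

Lemma colon_closed S a : ideal_pred_closed (fun p => in_gen S (a * p)).
Proof.
split=> [|p q|c p]; first by rewrite mulr0; apply: gen0.
  by rewrite mulrDr; apply: genD.
by rewrite mulrCA; apply: genM.
Qed.

Lemma gen_setU1 S m p : in_gen (fun s => S s \/ s = m) p <->
  exists2 q, in_gen S q & exists c, p = q + m * c.
Proof.
split; last first.
  case=> q qS [c ->]; apply: genD; last by apply: genMr; apply: gen_mem; right.
  by apply: (gen_sub _ qS) => s Ss; apply: gen_mem; left.
move: p; apply: gen_ind => [|s [Ss|->]]; last 2 first.
- by exists s; [apply: gen_mem | exists 0; rewrite mulr0 addr0].
- by exists 0; [apply: gen0 | exists 1; rewrite mulr1 add0r].
split=> [|_ _ [q qS [c ->]] [q' q'S [c' ->]]|a _ [q qS [c ->]]].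
- by exists 0; [apply: gen0 | exists 0; rewrite mulr0 addr0].
- by exists (q + q'); [apply: genD | exists (c + c'); rewrite mulrDr addrACA].
- by exists (a * q); [apply: genM | exists (a * c); rewrite mulrDr mulrCA].
Qed.

(** Non-zero-divisors modulo the ideal generated by [S]. *)
Definition nzd S a := forall p, in_gen S (a * p) -> in_gen S p.

End GeneratedIdeals.

(** * Complete and elementary symmetric polynomials *)

Section Symmetric.
Variable n : nat.
Local Notation P := (zpoly n).

Lemma mcoeff_hsym d i (m : 'X_{1..n}) :
  (hsym n d i)@_m = ((mdeg m == d) && [forall j : 'I_n, (i <= j)%N ==> (m j == 0%N)])%:R.
Proof.
rewrite /hsym raddf_sum /=.
case: (ltnP (mdeg m) d.+1) => md; last first.
  rewrite big1 => [|u /andP[/eqP ud _]]; last first.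
    rewrite mcoeffX; case: eqP => // um; move: md; rewrite -um.
    by rewrite leqNgt ltnS ud leqnn.
  by case: eqP => // E; move: md; rewrite E ltnn.
rewrite big_mkcond (bigD1 (BMultinom md)) //= big1 => [|u um]; last first.
  case: ifP => // _; rewrite mcoeffX; case: eqP => // E.
  by case/eqP: um; apply: val_inj.
by rewrite addr0 mcoeffX eqxx; case: ifP.
Qed.

Lemma hsym0 i : hsym n 0 i = 1.
Proof.
apply/mpolyP=> m; rewrite mcoeff_hsym mcoeff1 mdeg_eq0.
case: eqP => //= ->; rewrite (_ : [forall j, _]) //; apply/forallP=> j.
by rewrite mnm0E eqxx implybT.
Qed.

Lemma hsymS0 d : hsym n d.+1 0 = 0.
Proof.
apply/mpolyP=> m; rewrite mcoeff_hsym mcoeff0; case: forallP => [h|]; last by rewrite andbF.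
have -> : m = 0%MM.
  by apply/mnmP=> j; rewrite mnm0E; apply/eqP; have := h j; rewrite leq0n.
by rewrite mdeg0.
Qed.

Lemma hsymS d (i : 'I_n) :
  hsym n d.+1 i.+1 = hsym n d.+1 i + 'X_i * hsym n d i.+1.
Proof.
apply/mpolyP=> m; rewrite mcoeffD !mcoeff_hsym.
have vanishS (u : 'X_{1..n}) : [forall j : 'I_n, (i <= j)%N ==> (u j == 0%N)] =
    [forall j : 'I_n, (i.+1 <= j)%N ==> (u j == 0%N)] && (u i == 0%N).
  apply/forallP/andP=> [h|[/forallP h ui] j].
    split; last by have := h i; rewrite leqnn.
    by apply/forallP=> j; apply/implyP=> /ltnW ij; have := h j; rewrite ij.
  apply/implyP; rewrite leq_eqVlt => /orP[/eqP ij|ij]; last by have := h j; rewrite ij.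
  by rewrite (_ : j = i) //; apply: val_inj.
rewrite vanishS; case: (posnP (m i)) => mi.
  rewrite (_ : ('X_i * _)@_m = 0) ?addr0 ?mi ?andbT //.
  rewrite mulrC; apply/eqP; rewrite mcoeff_eq0 (perm_mem (msuppMX _ _)).
  by apply/mapP=> -[u _ mE]; move: mi; rewrite mE mnmDE mnm1E eqxx.
have mE : m = (U_(i) + (m - U_(i)))%MM.
  by rewrite addmC submK //; apply/mnm_lepP=> j; rewrite mnm1E; case: eqP => // <-.
rewrite !andbF add0r mulrC {3}mE mcoeffMX mcoeff_hsym.
rewrite {1}mE mdegD mdeg1 add1n eqSS; congr (_ && _)%:R.
apply: eq_forallb => j.
rewrite mnmBE mnm1E; case: (i =P j) => [<-|_]; first by rewrite ltnn.
by rewrite subn0.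
Qed.

End Symmetric.

Section SymmetricRelations.
Variable n : nat.
Local Notation P := (zpoly n).

(** The elementary symmetric polynomial [e_d(x_(i+1), ..., x_n)]. *)
Definition esuf d i : P :=
  \sum_(S : {set 'I_n} | (#|S| == d) && [forall p in S, (i <= p)%N]) \prod_(p in S) 'X_p.

Lemma esuf_mesym d : esuf d 0 = mesym n int d.
Proof.
by apply: eq_bigl => S; rewrite (_ : [forall p in S, _]) ?andbT //; apply/forall_inP.
Qed.

Lemma esuf0 i : esuf 0 i = 1.
Proof.
rewrite /esuf (big_pred1 set0) ?big_set0 // => S; rewrite cards_eq0 /=.
by case: eqP => //= ->; apply/forall_inP=> p; rewrite inE.
Qed.

Lemma esufS_oversize d : esuf d.+1 n = 0.
Proof.
apply: big1 => S /andP[/eqP Sd /forall_inP Sn].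
have /card_gt0P[p /Sn] : (0 < #|S|)%N by rewrite Sd.
by rewrite leqNgt ltn_ord.
Qed.

Lemma esufS d (i : 'I_n) : esuf d.+1 i = esuf d.+1 i.+1 + 'X_i * esuf d i.+1.
Proof.
rewrite /esuf (bigID (fun S : {set 'I_n} => i \in S)) /= addrC; congr (_ + _).
  apply: eq_bigl => S; rewrite -andbA; congr (_ && _).
  apply/andP/forall_inP=> [[/forall_inP Si iS] p pS|Si].
    rewrite ltn_neqAle Si // andbT; apply: contraNneq iS => ip.
    by rewrite (_ : i = p) //; apply: val_inj.
  split; first by apply/forall_inP=> p /Si /ltnW.
  by apply/negP=> /Si; rewrite ltnn.
rewrite (reindex_onto (fun S => i |: S) (fun S => S :\ i)) /=; last first.
  by move=> S /andP[_ iS]; rewrite setD1K.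
rewrite mulr_sumr; apply: eq_big => [S|S /andP[/andP[_ _] /eqP SE]]; last first.
  by rewrite big_setU1 // -SE !inE eqxx.
rewrite setU11 andbT; apply/andP/andP=> [[/andP[/eqP Sd /forall_inP Si] /eqP SE]|].
  have iS : i \notin S by rewrite -SE !inE eqxx.
  split; first by rewrite -eqSS -Sd cardsU1 iS.
  apply/forall_inP=> p pS; rewrite ltn_neqAle Si ?inE ?pS ?orbT // andbT.
  by apply: contraNneq iS => ip; rewrite (_ : i = p) //; apply: val_inj.
case=> /eqP Sd /forall_inP Si.
have iS : i \notin S by apply/negP=> /Si; rewrite ltnn.
split; last by rewrite setU1K.
rewrite cardsU1 iS Sd eqxx; apply/forall_inP=> p; rewrite !inE => /orP[/eqP-> //|/Si].
exact: ltnW.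
Qed.

(** The generating series of the [h_d(x_1, ..., x_i)] is the product of that of
    the [(-1)^d e_d(x_(i+1), ..., x_n)] and of the inverse of
    [(1 - x_1 t) ... (1 - x_n t)]. So this difference lies in the ideal of
    symmetric polynomials without constant term; the proofs only use the
    recurrence [sym_gapS], upwards in [i] for [hsym_mod_esuf] and downwards for
    [mesym_mod_hsym]. *)
Definition sym_gap d i : P := hsym n d i - (-1) ^+ d * esuf d i.

Lemma sym_gap0 i : sym_gap 0 i = 0.
Proof. by rewrite /sym_gap hsym0 esuf0 mul1r subrr. Qed.

Lemma sym_gapS d (i : 'I_n) :
  sym_gap d.+1 i.+1 = sym_gap d.+1 i + 'X_i * sym_gap d i.+1.
Proof.
by rewrite /sym_gap hsymS esufS exprS; ring.
Qed.

Lemma hsym_mod_esuf S i d : (i <= n)%N ->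
  (forall d, in_gen S (mesym n int d.+1)) -> in_gen S (sym_gap d i).
Proof.
move=> le_in eS; elim: i le_in d => [_|i IHi lt_in] d.
  case: d => [|d]; first by rewrite sym_gap0; apply: gen0.
  by rewrite /sym_gap hsymS0 esuf_mesym sub0r; apply/genN/genM.
elim: d => [|d IHd]; first by rewrite sym_gap0; apply: gen0.
rewrite (sym_gapS d (Ordinal lt_in)).
by apply: genD; [apply/IHi/ltnW | apply: genM].
Qed.

Lemma mesym_mod_hsym S d :
  (forall d, in_gen S (hsym n d.+1 n)) -> in_gen S (mesym n int d.+1).
Proof.
move=> hS.
suff gapS i : (i <= n)%N -> forall d, in_gen S (sym_gap d i).
  have := gapS 0%N isT d.+1; rewrite /sym_gap hsymS0 esuf_mesym sub0r => /genN.
  by rewrite opprK => /(genM ((-1) ^+ d.+1)); rewrite mulrA -expr2 sqrr_sign mul1r.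
move=> le_in; rewrite -(subKn le_in); elim: (n - i)%N {le_in} => [|j IHj] {}d.
  rewrite subn0; case: d => [|d]; first by rewrite sym_gap0; apply: gen0.
  by rewrite /sym_gap esufS_oversize mulr0 subr0.
have [le_nj|lt_jn] := leqP n j.
  by rewrite (_ : n - j.+1 = n - j)%N //; lia.
case: d => [|d]; first by rewrite sym_gap0; apply: gen0.
have lt_in : (n - j.+1 < n)%N by lia.
have := sym_gapS d (Ordinal lt_in); rewrite /= subnSK // => E.
rewrite -[sym_gap _ _](addrK ('X_(Ordinal lt_in) * sym_gap d (n - j))) -E.
by apply: genB => //; apply: genM.
Qed.

End SymmetricRelations.

(** * Non-zero-divisors modulo triangular families *)

(** Division by a monic [M] determines the coefficients of [F] from the top
    ones of [M * F], by descending induction on the degree. *)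
Lemma monic_mul_coef_gen (A : comNzRingType) (S : A -> Prop) (M F : {poly A}) :
  M \is monic -> (forall d, (size M <= d.+1)%N -> in_gen S (M * F)`_d) ->
  forall d, in_gen S F`_d.
Proof.
move=> Mm MFS d; have [e] : exists e, (size F <= d + e)%N by exists (size F); lia.
elim: e d => [|e IHe] d Fde.
  by rewrite nth_default ?(leq_trans Fde) ?addn0 //; apply: gen0.
have M0 : (0 < size M)%N by rewrite size_poly_gt0 monic_neq0.
have := MFS (d + (size M).-1)%N; rewrite -{1}(prednK M0) ltnS leq_addl => /(_ isT).
rewrite coefM.
have lt_M : ((size M).-1 < (d + (size M).-1).+1)%N by rewrite ltnS leq_addl.
rewrite (bigD1 (Ordinal lt_M)) //= addnK.
rewrite (_ : M`_(size M).-1 = 1); last exact/monicP.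
rewrite mul1r => FdS; rewrite -[F`_d](addrK (\sum_(i < (d + (size M).-1).+1 |
  i != Ordinal lt_M) M`_i * F`_(d + (size M).-1 - i))).
apply: genB => //; apply: gen_sum => i iM.
have [lt_iM|le_Mi] := ltnP i (size M).-1.
  by apply/genM/IHe; lia.
rewrite nth_default ?mul0r; first exact: gen0.
apply: leq_trans (leqSpred _) _; rewrite ltn_neqAle le_Mi andbT.
by apply: contraNneq iM => iM; apply/eqP/val_inj.
Qed.

Section SplitVariable.
Variables (n : nat) (j : 'I_n).
Local Notation P := (zpoly n).

(** The polynomial [p] seen as a univariate polynomial in [x_j]. The coefficients
    are kept in the same ring, rather than in that of the polynomials in the
    other variables, so that one ring serves for all [j]. *)
Definition split_var (p : P) : {poly P} :=
  mmap (polyC \o @mpolyC n int) (fun i => if i == j then 'X else ('X_i)%:P) p.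

HB.instance Definition _ := GRing.RMorphism.copy split_var
  (mmap (polyC \o @mpolyC n int) (fun i => if i == j then 'X else ('X_i : P)%:P)).

Lemma split_var0 : split_var 0 = 0. Proof. exact: rmorph0. Qed.
Lemma split_var1 : split_var 1 = 1. Proof. exact: rmorph1. Qed.
Lemma split_varD p q : split_var (p + q) = split_var p + split_var q.
Proof. exact: rmorphD. Qed.
Lemma split_varM p q : split_var (p * q) = split_var p * split_var q.
Proof. exact: rmorphM. Qed.

Lemma split_varX i : split_var 'X_i = if i == j then 'X else ('X_i)%:P.
Proof. by rewrite /split_var mmapX mmap1U. Qed.

Lemma split_varK p : (split_var p).['X_j] = p.
Proof.
rewrite {2}(mpolyE p) /split_var /mmap horner_sum; apply: eq_bigr => m _.
rewrite hornerCM mul_mpolyC; congr (_ *: _).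
rewrite /mmap1 horner_prod [RHS]mpolyXE_id.
apply: eq_bigr => i _; rewrite horner_exp; congr (_ ^+ _).
by case: eqP => [->|_]; rewrite ?hornerX ?hornerC.
Qed.

Definition var_free (p : P) := split_var p = p%:P.

Lemma split_var_coef_gen S p : (forall s, S s -> var_free s) ->
  in_gen S p -> forall d, in_gen S (split_var p)`_d.
Proof.
move=> Sj; move: p; apply: gen_ind => [|s Ss d].
  split=> [d|p q pS qS d|c p pS d].
  - by rewrite split_var0 coef0; apply: gen0.
  - by rewrite split_varD coefD; exact: (genD (pS d) (qS d)).
  - by rewrite split_varM coefM; apply: gen_sum => i _; apply: genM.
by rewrite Sj // coefC; case: eqP => _; [apply: gen_mem | apply: gen0].
Qed.

Lemma gen_of_split_var_coef S (F : {poly P}) : (forall d, in_gen S F`_d) -> in_gen S F.['X_j].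
Proof. by move=> FS; rewrite horner_coef; apply: gen_sum => i _; apply: genMr. Qed.

Lemma nzd_monic S m : (forall s, S s -> var_free s) ->
  split_var m \is monic -> nzd S m.
Proof.
move=> Sj mm p mpS; rewrite -(split_varK p); apply: gen_of_split_var_coef.
apply: (monic_mul_coef_gen mm) => d _; rewrite -split_varM.
exact: split_var_coef_gen.
Qed.

(** Modulo [S] and [m], every polynomial has a remainder of degree less than
    that of [m] in [x_j], and such a remainder is in the ideal only if its
    coefficients are in the ideal generated by [S]. Multiplication by [a], which
    is constant in [x_j], acts on these coefficients. *)
Lemma nzd_adjoin_monic S m a : (forall s, S s -> var_free s) ->
  split_var m \is monic -> var_free a -> nzd S a ->
  nzd (fun s => S s \/ s = m) a.
Proof.
move=> Sj mm aj aS p /gen_setU1[q qS [c apE]].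
pose M := split_var m; pose Q := Pdiv.Ring.rdivp (split_var p) M; pose r := Pdiv.Ring.rmodp (split_var p) M.
have pE : split_var p = Q * M + r by apply: Pdiv.RingMonic.rdivp_eq.
have arE : M * (split_var c - a *: Q) = a *: r - split_var q.
  have : split_var (a * p) = split_var (q + m * c) by rewrite apE.
  rewrite split_varM split_varD split_varM aj pE -/M -!mul_polyC => E.
  rewrite mulrBr (_ : M * split_var c = a%:P * (Q * M + r) - split_var q); last first.
    by rewrite E addrC addKr.
  by rewrite mulrDr addrAC [M * _]mulrC -[_ * Q * M]mulrA [_ + _ * r]addrC addrK.
(* up to [S], this product with [M] has degree less than that of [M] *)
have QS d : in_gen S (split_var c - a *: Q)`_d.
  apply: (monic_mul_coef_gen mm) => e le_Me; rewrite arE coefB coefZ.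
  rewrite nth_default ?mulr0 ?sub0r; first exact/genN/split_var_coef_gen.
  by rewrite -ltnS (leq_trans _ le_Me) // Pdiv.Ring.ltn_rmodpN0 ?monic_neq0.
have rS d : in_gen S r`_d.
  apply: aS; rewrite -coefZ -[a *: r](subrK (split_var q)) -arE coefD.
  apply: genD; last exact: split_var_coef_gen.
  by rewrite coefM; apply: gen_sum => i _; exact: (genM _ (QS _)).
apply/gen_setU1; exists r.['X_j]; first exact: gen_of_split_var_coef.
by exists Q.['X_j]; rewrite -{1}(split_varK p) pE hornerD hornerM split_varK addrC mulrC.
Qed.

End SplitVariable.

(** * The ideals of a lattice path and their colon ideals *)

Section PathIdeals.
Variable n : nat.
Local Notation P := (zpoly n).
Implicit Types (F G : nat -> nat) (i j : 'I_n) (p q : P).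

Lemma hsym_var_free j d (l : nat) : (l <= j)%N -> var_free j (hsym n d l).
Proof.
elim: l d => [|i IHi] d; first by case: d => [|d] _; rewrite /var_free ?hsym0 ?hsymS0 ?split_var1 ?split_var0.
move=> lt_ij; elim: d => [|d IHd]; first by rewrite /var_free hsym0 split_var1.
have lt_in : (i < n)%N by apply: leq_trans lt_ij (ltnW (ltn_ord j)).
rewrite /var_free (hsymS d (Ordinal lt_in)) split_varD split_varM /= split_varX.
rewrite (IHi _ (ltnW lt_ij)) IHd ifN ?rmorphD ?rmorphM //.
by apply/eqP=> ij; move: lt_ij; rewrite -ij ltnn.
Qed.

Lemma split_var_hsym j d :
  split_var j (hsym n d j.+1) \is monic /\ size (split_var j (hsym n d j.+1)) = d.+1.
Proof.
elim: d => [|d [IHm IHs]]; first by rewrite hsym0 split_var1 monic1 size_poly1.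
rewrite hsymS split_varD split_varM /= split_varX eqxx hsym_var_free //.
have sX : size ('X * split_var j (hsym n d j.+1)) = d.+2.
  by rewrite mulrC size_mulX ?IHs // monic_neq0.
have sC : (size (hsym n d.+1 j)%:P < size ('X * split_var j (hsym n d j.+1))%R)%N.
  by rewrite sX (leq_ltn_trans (size_polyC_leq1 _)).
by rewrite monicE addrC lead_coefDl // size_polyDl // sX -monicE monicMl ?monicX.
Qed.

(** The family is restricted to a set [A] of indices because the arguments below
    remove one generator from it. *)
Definition path_gens F (A : pred nat) : P -> Prop :=
  fun p => exists2 j : 'I_n, A j & p = hsym n (F j.+1).+1 j.+1.

Definition path_ideal F := in_gen (path_gens F predT).

Lemma path_ideal_gen F i : path_ideal F (hsym n (F i.+1).+1 i.+1).
Proof. by apply: gen_mem; exists i. Qed.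

Lemma path_idealE F i p : path_ideal F p <->
  in_gen (fun s => path_gens F (predC1 (i : nat)) s \/ s = hsym n (F i.+1).+1 i.+1) p.
Proof.
split; apply: gen_sub => s; last first.
  by case=> [[j _ ->]|->]; apply: path_ideal_gen.
case=> j _ ->; apply: gen_mem; have [->|ji] := eqVneq j i; first by right.
by left; exists j.
Qed.

(** The members of the family of index below [i] and [a] itself are polynomials
    in [x_1, ..., x_(i+1)], in which [a] is monic for the last variable; each
    later member is monic in a new variable. Hence [nzd_monic] applies to the
    former, and [nzd_adjoin_monic] to the latter, one after the other. *)
Lemma nzd_path_gens F i a : (forall j, (i < j)%N -> var_free j a) ->
  split_var i a \is monic -> nzd (path_gens F (predC1 (i : nat))) a.
Proof.
move=> a_free a_monic.
suff nzd_below l : (i < l <= n)%N -> nzd (path_gens F (fun a : nat => (a < l)%N && (a != i))) a.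
  have := nzd_below n; rewrite ltn_ord leqnn => /(_ isT).
  move=> aS p apS; have := aS p; set S := path_gens F (predC1 _) in apS *.
  have eqS s : S s <-> path_gens F (fun a : nat => (a < n)%N && (a != i)) s.
    by split=> -[j ji ->]; exists j => //; move: ji; rewrite ltn_ord.
  move=> h; suff: in_gen (path_gens F (fun a : nat => (a < n)%N && (a != i))) p.
    by apply: gen_sub => s /eqS Ss; apply: gen_mem.
  by apply: h; move: apS; apply: gen_sub => s /eqS Ss; apply: gen_mem.
elim: l => // l IHl /andP[]; rewrite ltnS leq_eqVlt => /orP[/eqP il _|lt_il lt_ln].
  apply: (@nzd_monic n i) => // _ [j /andP[jl ji] ->].
  by apply: hsym_var_free; rewrite ltn_neqAle ji -ltnS il.
pose m := Ordinal lt_ln; have IH := IHl; rewrite lt_il (ltnW lt_ln) in IH.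
have S_free s : path_gens F (fun a : nat => (a < l)%N && (a != i)) s -> var_free m s.
  by case=> j /andP[jl _] ->; apply: hsym_var_free.
have := nzd_adjoin_monic S_free (split_var_hsym m (F m.+1).+1).1 (a_free m lt_il) (IH isT).
move=> nzd_l p apS; have {nzd_l} := nzd_l p.
have eqS s : path_gens F (fun a : nat => (a < l.+1)%N && (a != i)) s <->
   path_gens F (fun a : nat => (a < l)%N && (a != i)) s \/ s = hsym n (F m.+1).+1 m.+1.
  split=> [[j /andP[jl ji] ->]|[[j /andP[jl ji] ->]|->]].
  - move: jl; rewrite ltnS leq_eqVlt => /orP[/eqP jl|jl].
      by right; rewrite (_ : j = m) //; apply: val_inj.
    by left; exists j; rewrite ?jl.
  - by exists j; rewrite // ltnW.
  - by exists m; rewrite //= ltnSn; apply: contraTneq lt_il => ->; rewrite ltnn.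
move=> h; suff: in_gen (fun s => path_gens F (fun a : nat => (a < l)%N && (a != i)) s \/
    s = hsym n (F m.+1).+1 m.+1) p.
  by apply: gen_sub => s /eqS Ss; apply: gen_mem.
by apply: h; move: apS; apply: gen_sub => s /eqS Ss; apply: gen_mem.
Qed.

(** One box of difference between two paths. Both ideals contain the ideal [K]
    of the generators of index other than [i], and modulo [K] the generator of
    index [i] of the larger path is [x_(i+1)] times that of the smaller one. *)
Section OneBox.
Variables (F G : nat -> nat) (i : 'I_n).
Hypotheses (F_i : F i.+1 = (G i.+1).+1) (F_left : (0 < i)%N -> F i = F i.+1).
Hypothesis F_eq : forall j, j != i -> F j.+1 = G j.+1.

Let K := path_gens F (predC1 (i : nat)).
Let g := hsym n (G i.+1).+1 i.+1.

Let hsym_left : in_gen K (hsym n (F i.+1).+1 i).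
Proof.
case: (posnP i) => [->|i0]; first by rewrite hsymS0; apply: gen0.
have lt_in : (i.-1 < n)%N by rewrite prednK // ltnW.
apply: gen_mem; exists (Ordinal lt_in) => /=; last by rewrite prednK // F_left.
by rewrite /= -[X in _ != X](prednK i0) neq_ltn ltnSn.
Qed.

Let big_idealE p : path_ideal F p <-> exists2 q, in_gen K q & exists c, p = q + 'X_i * g * c.
Proof.
have hE : hsym n (F i.+1).+1 i.+1 = hsym n (F i.+1).+1 i + 'X_i * g.
  by rewrite hsymS -/g F_i.
split=> [/(path_idealE F i)/gen_setU1|]; last first.
  case=> q qK [c ->]; apply/(path_idealE F i)/gen_setU1.
  exists (q - hsym n (F i.+1).+1 i * c); first by apply: genB => //; apply: genMr.
  by exists c; rewrite hE; ring.
case=> q qK [c ->]; exists (q + hsym n (F i.+1).+1 i * c).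
  by apply: genD => //; apply: genMr.
by exists c; rewrite hE; ring.
Qed.

Let small_idealE p : path_ideal G p <-> exists2 q, in_gen K q & exists c, p = q + g * c.
Proof.
split=> [/(path_idealE G i)/gen_setU1|] h; first case: h => q qG [c ->].
  exists q; last by exists c.
  by move: qG; apply: gen_sub => s [j ji ->]; apply: gen_mem; exists j; rewrite // F_eq.
case: h => q qK [c ->]; apply/(path_idealE G i)/gen_setU1; exists q; last by exists c.
by move: qK; apply: gen_sub => s [j ji ->]; apply: gen_mem; exists j; rewrite // F_eq.
Qed.

Lemma box_colon p : path_ideal F ('X_i * p) <-> path_ideal G p.
Proof.
split=> [/big_idealE[q qK [c xpE]]|/small_idealE[q qK [c ->]]]; last first.
  apply/big_idealE; exists ('X_i * q); first exact: genM.
  by exists c; rewrite mulrDr mulrA.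
apply/small_idealE; exists (p - g * c); last by exists c; rewrite subrK.
apply: (@nzd_path_gens F i 'X_i) => [j ij||].
- by rewrite /var_free split_varX ifN // neq_ltn ij.
- by rewrite split_varX eqxx monicX.
- by rewrite mulrBr xpE mulrA addrK.
Qed.

Lemma box_transporter p : (forall s, path_ideal G s -> path_ideal F (p * s)) ->
  exists q, path_ideal F (p - 'X_i * q).
Proof.
move=> /(_ g (path_ideal_gen G i)) /big_idealE[q qK [c pgE]]; exists c.
apply/big_idealE; exists (p - 'X_i * c); last by exists 0; rewrite mulr0 addr0.
apply: (@nzd_path_gens F i g) => [j ij||].
- by apply: hsym_var_free.
- by case: (split_var_hsym i (G i.+1).+1).
- by rewrite (_ : g * _ = q) // mulrBr mulrC pgE; ring.
Qed.

End OneBox.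

Definition lattice_path F :=
  F n = 0%N /\ forall a : nat, (a < n)%N -> (F a.+1 <= F a <= (F a.+1).+1)%N.

(** The ideal of a path contains more than its generators: by the recurrence for
    complete symmetric polynomials, all degrees above the path occur. In
    particular a lower path has a larger ideal. *)
Lemma hsym_path_ideal F : lattice_path F ->
  forall (l : nat) d, (l <= n)%N -> (F l < d)%N -> path_ideal F (hsym n d l).
Proof.
move=> [_ Fstep]; elim=> [|i IHi] d le_in; first by case: d => // d _; rewrite hsymS0; apply: gen0.
elim: d => // d IHd; rewrite ltnS leq_eqVlt => /orP[/eqP<-|lt_Fd].
  exact: (path_ideal_gen F (Ordinal le_in)).
rewrite (hsymS d (Ordinal le_in)); apply: genD; last exact/genM/IHd.
by apply: IHi; [apply: ltnW | case/andP: (Fstep i le_in) => _; lia].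
Qed.

Lemma path_ideal_le F G : lattice_path G -> (forall i : nat, (0 < i <= n)%N -> (G i <= F i)%N) ->
  forall p, path_ideal F p -> path_ideal G p.
Proof.
move=> Gp GF; apply: gen_sub => _ [i _ ->]; apply: hsym_path_ideal => //.
by rewrite ltnS GF /=.
Qed.

Definition path_mon F G : P := \prod_(i < n) 'X_i ^+ (F i.+1 - G i.+1).

(** A box that can be removed from [F], keeping it a lattice path above [G]. *)
Lemma removable_box F G : lattice_path F -> lattice_path G -> F 0%N = G 0%N ->
  (forall i : nat, (i <= n)%N -> (G i <= F i)%N) -> (exists2 i : nat, (i <= n)%N & F i != G i) ->
  exists i : 'I_n, [/\ (G i.+1 < F i.+1)%N, F i = F i.+1, (i.+1 < n)%N & F i.+1 = (F i.+2).+1].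
Proof.
move=> [Fn Fs] [Gn Gs] FG0 GF [i1 i1n Fi1].
have lt1 : (G i1 < F i1)%N by rewrite ltn_neqAle eq_sym Fi1 GF.
(* among the places where the paths differ: maximal height, then rightmost *)
pose w (i : 'I_n.+1) := (F i * n.+1 + i)%N.
have [|i lt_i max_i] := @arg_maxnP _ (Ordinal (i1n : i1 < n.+1)%N) (fun i : 'I_n.+1 => G i < F i)%N w.
  by [].
have i0 : (0 < i)%N by case: (posnP i) lt_i => // ->; rewrite FG0 ltnn.
have i_n : (i < n)%N.
  by rewrite ltn_neqAle -ltnS ltn_ord andbT; apply: contraTneq lt_i => ->; rewrite Fn Gn.
have ip : (i.-1 < n)%N by lia.
have ipS : (i.-1 < n.+1)%N by lia.
have inS : (i.+1 < n.+1)%N by [].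
have := (max_i (Ordinal ipS), max_i (Ordinal inS)); rewrite /w /=.
have := (Fs _ ip, Fs _ i_n, Gs _ ip, Gs _ i_n, GF i.-1 (ltnW ip)); rewrite !prednK //.
case=> [[[[Fl Fr] Gl] Gr] GFl] [Ml Mr].
exists (Ordinal ip); rewrite /= !prednK //; split=> //.
  apply/eqP; rewrite eqn_leq; apply/andP; split; last by lia.
  rewrite leqNgt; apply/negP=> lt_F.
  have := Ml _; nia.
apply/eqP; rewrite eqn_leq; apply/andP; split; first by lia.
rewrite ltn_neqAle; apply/andP; split; last by lia.
apply/eqP=> Feq; have := Mr _; nia.
Qed.

(** [(I_F : x^(F-G)) = I_G] and [(I_F : I_G) = (x^(F-G)) + I_F], by removing the
    boxes between [F] and [G] one at a time. *)
Lemma path_colon F G : lattice_path F -> lattice_path G -> F 0%N = G 0%N ->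
  (forall i : nat, (i <= n)%N -> (G i <= F i)%N) ->
  (forall p, path_ideal F (path_mon F G * p) <-> path_ideal G p) /\
  (forall p, (forall s, path_ideal G s -> path_ideal F (p * s)) ->
     exists q, path_ideal F (p - path_mon F G * q)).
Proof.
move=> + Gp; have [N] := ubnP (\sum_(i < n.+1) (F i - G i)%N).
elim: N F => // N IHN F lt_N Fp FG0 GF.
have [/existsP[i Fi]|] := boolP [exists i : 'I_n.+1, F i != G i]; last first.
  move/existsPn=> FG; have {}FG (i : nat) : (i <= n)%N -> F i = G i.
    by move=> le_in; apply/eqP; have /negPn := FG (Ordinal (le_in : i < n.+1)%N).
  have m1 : path_mon F G = 1.
    by apply: big1 => i _; rewrite FG // subnn.
  have IFG p : path_ideal F p <-> path_ideal G p.
    by split; apply: gen_sub => _ [i _ ->]; [rewrite FG // | rewrite -FG //]; apply: path_ideal_gen.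
  rewrite m1; split=> p; first by rewrite mul1r.
  by move=> _; exists p; rewrite mul1r subrr; apply: gen0.
have [|j [lt_j Fl jn Fr]] := removable_box Fp Gp FG0 GF; first by exists i; rewrite // -ltnS.
pose F' a := if a == j.+1 then (F a).-1 else F a.
have F'E a : F' a = if a == j.+1 then (F a).-1 else F a by [].
have F'p : lattice_path F'.
  split; first by rewrite F'E ifN; [case: Fp | lia].
  move=> a an; have := Fp.2 a an; rewrite !F'E eqSS.
  case: (a =P j.+1) => [->|]; first by rewrite ifN; lia.
  by case: (a =P j) => [->|] //; lia.
have GF' a : (a <= n)%N -> (G a <= F' a)%N.
  by move=> an; rewrite F'E; case: eqP => [->|_]; [lia | apply: GF].
have F'0 : F' 0%N = G 0%N by rewrite F'E.
have lt_N' : (\sum_(a < n.+1) (F' a - G a) < N)%N.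
  apply: leq_trans (_ : \sum_(a < n.+1) (F a - G a) <= N)%N; last by [].
  have jn1 : (j.+1 < n.+1)%N by lia.
  rewrite (bigD1 (Ordinal jn1)) //= [X in (_ < X)%N](bigD1 (Ordinal jn1)) //=.
  rewrite -addSn; apply: leq_add; first by rewrite F'E eqxx; lia.
  by apply: leq_sum => a _; rewrite F'E; case: ifP => _; lia.
have [IHa IHb] := IHN F' lt_N' F'p F'0 GF'.
have F'j : F j.+1 = (F' j.+1).+1 by rewrite F'E eqxx; lia.
have F'o (a : 'I_n) : a != j -> F a.+1 = F' a.+1.
  by move=> aj; rewrite F'E eqSS ifN.
have Fl' : (0 < j)%N -> F j = F j.+1 by [].
have monE : path_mon F G = 'X_j * path_mon F' G.
  rewrite /path_mon (bigD1 j) //= [in RHS](bigD1 j) //= mulrA -exprS.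
  congr (_ ^+ _ * _); first by rewrite F'E eqxx; lia.
  by apply: eq_bigr => a aj; rewrite F'o.
split=> p.
  by rewrite monE -mulrA (box_colon F'j Fl' F'o) IHa.
move=> pGF; have [|q qE] := box_transporter F'j Fl' (p := p).
  move=> s sF'; apply: pGF; apply: (path_ideal_le Gp _ sF') => a /andP[_].
  exact: GF'.
have [|r rE] := IHb q.
  move=> s sG; apply/(box_colon F'j Fl' F'o); rewrite mulrA.
  rewrite -[_ * s](subrK (p * s)); apply: genD; last exact: pGF.
  by rewrite -mulrBl -[_ - p]opprB mulNr; apply/genN/genMr.
exists r; rewrite monE.
have -> : p - 'X_j * path_mon F' G * r = (p - 'X_j * q) + 'X_j * (q - path_mon F' G * r) by ring.
by apply: genD => //; apply/(box_colon F'j Fl' F'o).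
Qed.

End PathIdeals.

(** * States as lattice paths *)

Section States.
Variables n k : nat.
Local Notation P := (zpoly n).
Local Notation V := (V n k).
Implicit Types (x y z s t : V) (a b : nat) (i : 'I_n).

Definition set_gaps (A : {set 'I_n.+1}) a := #|[set p : 'I_n.+1 | (p < a)%N & p \notin A]|.

Lemma set_gaps0 A : set_gaps A 0 = 0%N.
Proof. by apply: eq_card0 => p; rewrite inE. Qed.

Lemma set_gapsS A (p : 'I_n.+1) : set_gaps A p.+1 = (set_gaps A p + (p \notin A))%N.
Proof.
rewrite /set_gaps; case pA: (p \in A) => /=.
  rewrite addn0; apply: eq_card => q; rewrite !inE ltnS leq_eqVlt.
  by case: eqP => //= /val_inj ->; rewrite pA andbF.
rewrite addnC -[RHS](_ : #|p |: [set q : 'I_n.+1 | (q < p)%N & q \notin A]| = _)%N; last first.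
  by rewrite cardsU1 !inE ltnn.
apply: eq_card => q; rewrite !inE ltnS leq_eqVlt.
by case: (eqVneq q p) => [->|qp]; rewrite ?eqxx ?pA //= val_eqE (negPf qp).
Qed.

Lemma set_gaps_end A : (set_gaps A n.+1 + #|A| = n.+1)%N.
Proof.
rewrite -[RHS]card_ord -(cardC A) addnC; congr (_ + _)%N.
by apply: eq_card => p; rewrite !inE ltn_ord.
Qed.

Definition gaps x := set_gaps (val x).

Lemma gaps0 x : gaps x 0 = 0%N. Proof. exact: set_gaps0. Qed.

Lemma gapsS x (p : 'I_n.+1) : gaps x p.+1 = (gaps x p + (p \notin val x))%N.
Proof. exact: set_gapsS. Qed.

Lemma gaps_end x : (gaps x n.+1 + k = n.+1)%N.
Proof. by have := set_gaps_end (val x); rewrite (eqP (valP x)). Qed.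

Lemma gaps_step x a : (a <= n)%N -> (gaps x a <= gaps x a.+1 <= (gaps x a).+1)%N.
Proof. by move=> an; rewrite (gapsS x (Ordinal (an : a < n.+1)%N)) /=; case: (_ \in _); lia. Qed.

Lemma gaps_mono x a b : (a <= b)%N -> (b <= n.+1)%N ->
  (gaps x a <= gaps x b <= gaps x a + (b - a))%N.
Proof.
move=> ab; rewrite -(subnKC ab); elim: (b - a)%N => [|c IHc] cn; first by rewrite addn0; lia.
have := gaps_step x (_ : a + c <= n)%N; rewrite addnS in cn *.
have := IHc (ltnW cn) => ? /(_ cn); lia.
Qed.

Lemma in_state x (p : 'I_n.+1) : (p \in val x) = (gaps x p.+1 == gaps x p).
Proof. by rewrite gapsS; case: (p \in _) => /=; lia. Qed.

Lemma vE x a : (a <= n.+1)%N -> (v x a + a = gaps x a + k)%N.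
Proof.
have vS (p : 'I_n.+1) : v x p = (v x p.+1 + (p \in val x))%N.
  rewrite /v; case px: (p \in val x); last first.
    rewrite addn0; apply: eq_card => q; rewrite !inE leq_eqVlt.
    by case: (val p =P q) => [/val_inj <-|//]; rewrite px.
  rewrite addnC -[RHS](_ : #|p |: [set q in val x | p.+1 <= q]| = _)%N; last first.
    by rewrite cardsU1 !inE ltnn andbF.
  apply: eq_card => q; rewrite !inE leq_eqVlt eq_sym.
  by case: (eqVneq q p) => [->|qp]; rewrite ?eqxx ?px //= val_eqE (negPf qp).
elim: a => [|a IHa] an.
  rewrite gaps0 addn0 add0n -[RHS](eqP (valP x)); apply: eq_card => q.
  by rewrite inE leq0n andbT.
have := IHa (ltnW an); have := vS (Ordinal an); have := gapsS x (Ordinal an) => /=.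
case: (Ordinal an \in val x) => /=; lia.
Qed.

Lemma state_of_path (F : nat -> nat) : F 0%N = 0%N -> (F n.+1 + k = n.+1)%N ->
  (forall a, (a <= n)%N -> (F a <= F a.+1 <= (F a).+1)%N) ->
  exists x, forall a, (a <= n.+1)%N -> gaps x a = F a.
Proof.
move=> F0 Fn Fs; pose A := [set p : 'I_n.+1 | F p.+1 == F p].
have gA a : (a <= n.+1)%N -> set_gaps A a = F a.
  elim: a => [|a IHa] an; first by rewrite set_gaps0 F0.
  have := set_gapsS A (Ordinal an); rewrite /= => ->; rewrite IHa ?(ltnW an) // inE /=.
  by have := Fs a an; lia.
have cA : #|A| == k.
  by rewrite -(eqn_add2l (F n.+1)) Fn -(gA n.+1) // set_gaps_end.
by exists (exist (fun A : {set 'I_n.+1} => #|A| == k) A cA).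
Qed.

(** Since [g_a] is half the defect of the triangle inequality for the heights of
    [x], [y], [z] at [a], it vanishes exactly when that of [y] is between the two
    others. *)
Lemma gdeg_pos x y z a : (a <= n.+1)%N ->
  gaps x a = gaps z a -> gaps y a != gaps x a -> (0 < gdeg x y z a)%N.
Proof.
move=> an; have := (gdegE x y z a, vE x an, vE y an, vE z an).
by rewrite /vdist; case=> [[[]]]; lia.
Qed.

Lemma gdeg_between x y z a : (a <= n.+1)%N ->
  (minn (gaps x a) (gaps z a) <= gaps y a <= maxn (gaps x a) (gaps z a))%N ->
  gdeg x y z a = 0%N.
Proof.
move=> an; have := (gdegE x y z a, vE x an, vE y an, vE z an).
by rewrite /vdist; case=> [[[]]]; lia.
Qed.

Lemma gdeg_off_by_one x y z a : (a <= n.+1)%N -> gaps x a = gaps z a ->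
  (gaps x a <= (gaps y a).+1)%N -> (gaps y a <= (gaps x a).+1)%N ->
  (gdeg x y z a <= 1)%N.
Proof.
move=> an; have := (gdegE x y z a, vE x an, vE y an, vE z an).
by rewrite /vdist; case=> [[[]]]; lia.
Qed.

Lemma gmon_between x y z :
  (forall a, (0 < a <= n)%N ->
     (minn (gaps x a) (gaps z a) <= gaps y a <= maxn (gaps x a) (gaps z a))%N) ->
  gmon x y z = 1.
Proof.
move=> btw; apply: big1 => i _; rewrite gdeg_between ?expr0 ?btw //= ltnS.
exact: ltnW.
Qed.

(** ** The ideals of coefficients *)

(** The positions [a] with [gaps x a = j] lie between two consecutive empty sites
    of [x], so this is the product of the variables over the interval that
    occurs in the definition of [W]. *)
Definition level_mon x y j : P :=
  \prod_(i < n | (gaps x i.+1 == j) && (gaps y i.+1 == j)) 'X_i.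

Definition level_gens x y : P -> Prop :=
  fun p => exists2 j, (0 < j <= n - k)%N & p = level_mon x y j.

Definition level_ideal x y := in_gen (level_gens x y).

Lemma level_monE x y j :
  level_mon x y j = \prod_(i < n) 'X_i ^+ ((gaps x i.+1 == j) && (gaps y i.+1 == j)).
Proof. by rewrite /level_mon big_mkcond; apply: eq_bigr => i _; case: ifP. Qed.

Lemma mon_dvd (e e' : 'I_n -> nat) : (forall i, (e i <= e' i)%N) ->
  \prod_(i < n) 'X_i ^+ e' i = (\prod_(i < n) 'X_i ^+ (e' i - e i)) * \prod_(i < n) 'X_i ^+ e i :> P.
Proof. by move=> ee; rewrite -big_split /=; apply: eq_bigr => i _; rewrite -exprD subnK. Qed.

Lemma level_idealC x y p : level_ideal x y p -> level_ideal y x p.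
Proof.
apply: gen_sub => _ [j jk ->]; apply: gen_mem; exists j => //.
by apply: eq_bigl => i; rewrite andbC.
Qed.

Lemma gmonC x y z : gmon x y z = gmon z y x.
Proof.
apply: eq_bigr => i _; congr (_ ^+ _).
by have := (gdegE x y z i.+1, gdegE z y x i.+1); rewrite /vdist; case; lia.
Qed.

(** Where [x] and [z] are both at height [j], either [y] is at height [j] too or
    the exponent [g] is positive; so the monomial of [(x, z)] at height [j]
    divides [gmon x y z] times that of [(x, y)]. *)
Lemma level_ideal_mulr x y z p : level_ideal x y p -> level_ideal x z (gmon x y z * p).
Proof.
move: p; apply: gen_ind => [|_ [j jk ->]].
  split=> [|p q|c p]; first by rewrite mulr0; apply: gen0.
    by rewrite mulrDr; apply: genD.
  by rewrite mulrCA; apply: genM.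
rewrite level_monE /gmon -big_split /=.
under eq_bigr do rewrite -exprD.
rewrite (@mon_dvd (fun i => ((gaps x i.+1 == j) && (gaps z i.+1 == j)) : nat)) => [|i].
  by apply: genM; rewrite -level_monE; apply: gen_mem; exists j.
have := @gdeg_pos x y z i.+1; rewrite ltnS (ltnW (ltn_ord i)) => /(_ isT).
by case: (gaps x i.+1 =P j) => //= ->; case: (gaps z i.+1 =P j) => //= ->; case: eqP => //=; lia.
Qed.

Lemma level_ideal_mull x y z p : level_ideal y z p -> level_ideal x z (gmon x y z * p).
Proof.
by move=> /level_idealC/(@level_ideal_mulr z y x)/level_idealC; rewrite gmonC.
Qed.

(** If the paths never meet at height [j], then [level_mon x y j] is an empty
    product. *)
Lemma level_ideal_far x y j : (0 < j <= n - k)%N ->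
  (forall a, (0 < a <= n)%N -> gaps x a = j -> gaps y a <> j) ->
  forall p, level_ideal x y p.
Proof.
move=> jk far p; rewrite -[p]mulr1; apply: genM; apply: gen_mem; exists j => //.
rewrite /level_mon big_pred0 // => i; apply/negP=> /andP[/eqP xj /eqP yj].
by apply: (far i.+1) => //=; rewrite ltn_ord.
Qed.

End States.

(** * The relations of B(n,k), coefficient by coefficient *)

Section Relations.
Variables n k : nat.
Local Notation P := (zpoly n).
Local Notation V := (V n k).
Local Notation N := (ideal_gen (@B_rel n k)).
Implicit Types (x y z s t : V) (a b : nat) (i j : 'I_n) (g h : B0 n k).

Lemma rel_idealMl h g : g \in (N : {pred B0 n k}) -> h * g \in (N : {pred B0 n k}).
Proof. by move=> gN; have [_ /(_ h g gN)[]] := idealP N. Qed.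
Lemma rel_idealMr h g : g \in (N : {pred B0 n k}) -> g * h \in (N : {pred B0 n k}).
Proof. by move=> gN; have [_ /(_ h g gN)[]] := idealP N. Qed.
Lemma rel_idealZ (c : P) g : g \in (N : {pred B0 n k}) -> c *: g \in (N : {pred B0 n k}).
Proof. by rewrite -B0_scalarl; apply: rel_idealMl. Qed.
Lemma rel_ideal_gen g : B_rel g -> g \in (N : {pred B0 n k}).
Proof. by move=> rg; apply/asboolP=> I; apply. Qed.

Lemma set2_capE (A : {set 'I_n.+1}) (p q : 'I_n.+1) : p != q ->
  (A :&: [set p; q] == [set p]) = (p \in A) && (q \notin A).
Proof.
move=> pq; apply/eqP/andP=> [/setP Apq|[pA qA]].
  have := (Apq p, Apq q); rewrite !inE !eqxx orbT (eq_sym q) (negPf pq) !andbT.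
  by case=> -> ->.
apply/setP=> r; rewrite !inE; case: (r =P p) => [->|_]; first by rewrite pA.
by case: eqP => [->|_]; rewrite ?(negPf qA) ?andbF.
Qed.

Lemma set2_capE' (A : {set 'I_n.+1}) (p q : 'I_n.+1) : p != q ->
  (A :&: [set p; q] == [set q]) = (q \in A) && (p \notin A).
Proof. by rewrite setUC eq_sym; apply: set2_capE. Qed.

Lemma lo_hi i : lo i != hi i.
Proof. by rewrite -val_eqE /= /bump /= add1n neq_ltn ltnSn. Qed.

Definition Rmove i x y := (val x :&: [set lo i; hi i] == [set lo i]) &&
  (val y == (val x :\ lo i) :|: [set hi i]).
Definition Lmove i x y := (val x :&: [set lo i; hi i] == [set hi i]) &&
  (val y == (val x :\ hi i) :|: [set lo i]).

(** The relations between [x] and [y] in the definitions of [Rgen] and [Lgen], in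
    a form in which exchanging [x] and [y] exchanges [p] and [q]. *)
Definition moved (p q : 'I_n.+1) x y :=
  [/\ p \in val x, q \notin val x, p \notin val y, q \in val y &
     forall r, r != p -> r != q -> (r \in val x) = (r \in val y)].

Lemma movedP (p q : 'I_n.+1) x y : p != q ->
  moved p q x y <-> (p \in val x) && (q \notin val x) /\ val y = (val x :\ p) :|: [set q].
Proof.
move=> pq; split=> [[px qx py qy xy]|[/andP[px qx] yE]].
  split; first by rewrite px.
  apply/setP=> r; rewrite !inE; case: (eqVneq r p) => [->|rp]; first by rewrite (negPf pq) (negPf py).
  by case: (eqVneq r q) => [->|rq]; rewrite ?orbT ?orbF //= xy.
split=> //; rewrite ?yE ?inE ?eqxx ?(negPf pq) ?orbT // => r rp rq.
by rewrite !inE rp (negPf rq) orbF.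
Qed.

Lemma RmoveP i x y : Rmove i x y <-> moved (lo i) (hi i) x y.
Proof.
rewrite /Rmove set2_capE ?lo_hi //; have := movedP x y (lo_hi i) => M.
by split=> [/andP[? /eqP ?]|/M[? ->]]; [apply/M | apply/andP].
Qed.

Lemma LmoveP i x y : Lmove i x y <-> moved (hi i) (lo i) x y.
Proof.
have hl : hi i != lo i by rewrite eq_sym lo_hi.
rewrite /Lmove set2_capE' ?lo_hi //; have := movedP x y hl => M.
by split=> [/andP[? /eqP ?]|/M[? ->]]; [apply/M | apply/andP].
Qed.

Lemma sum_fE (M : rel V) x y :
  (\sum_(p : V * V | M p.1 p.2) f p.1 p.2) x y = (M x y)%:R :> P.
Proof.
rewrite !fct_sumE big_mkcond (bigD1 (x, y)) //= big1 => [|[s t] st].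
  by rewrite addr0 /f !eqxx; case: (M x y).
rewrite /f /=; case: ifP => // _; case: andP => // -[/eqP xs /eqP yt].
by rewrite xs yt eqxx in st.
Qed.

Lemma RgenE i x y : @Rgen n k i x y = (Rmove i x y)%:R.
Proof. exact: (sum_fE (Rmove i)). Qed.

Lemma LgenE i x y : @Lgen n k i x y = (Lmove i x y)%:R.
Proof. exact: (sum_fE (Lmove i)). Qed.

Lemma eq_gaps_below x y a : (a <= n)%N ->
  (forall r : 'I_n.+1, (r < a)%N -> (r \in val x) = (r \in val y)) -> gaps x a = gaps y a.
Proof.
elim: a => [|a IHa] an xy; first by rewrite !gaps0.
have ltan : (a < n.+1)%N by lia.
rewrite (gapsS x (Ordinal ltan)) (gapsS y (Ordinal ltan)) /= xy //.
by rewrite IHa ?(ltnW an) // => r ra; apply: xy; apply: ltnW.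
Qed.

(** A particle moving by two sites: at the height just above that of [x] at
    [a], the two paths never meet. *)
Lemma far_of_jump x y a (p0 p1 p2 : 'I_n.+1) :
  (val p0 = a)%N -> (val p1 = a.+1)%N -> (val p2 = a.+2)%N ->
  p0 \in val x -> p1 \notin val x -> p2 \notin val x ->
  p0 \notin val y -> p1 \notin val y ->
  (forall r : 'I_n.+1, (r < a)%N -> (r \in val x) = (r \in val y)) ->
  forall p, level_ideal x y p.
Proof.
move=> E0 E1 E2 x0 x1 x2 y0 y1 xy.
have p2n := ltn_ord p2; rewrite E2 in p2n.
have an : (a <= n)%N by lia.
have := eq_gaps_below an xy.
have := (gapsS x p0, gapsS x p1, gapsS x p2, gapsS y p0, gapsS y p1).
rewrite !E0 !E1 !E2 x0 x1 x2 y0 y1 /= addn0 !addn1 => -[[[[X1 X2] X3] Y1] Y2] XY.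
apply: (@level_ideal_far n k x y (gaps x a).+1).
  have := gaps_mono x p2n (leqnn n.+1); rewrite X3 X2 X1 => /andP[+ _].
  by have := gaps_end x; lia.
move=> b /andP[b0 bn] xb yb.
have [lb|lb] := leqP b a.+1.
  by have := gaps_mono x lb (_ : a.+1 <= n.+1)%N; rewrite X1 xb; lia.
by have := gaps_mono y lb (_ : b <= n.+1)%N; rewrite Y2 Y1 -XY yb; lia.
Qed.

Lemma ord_neq (p q : 'I_n.+1) : (p < q)%N || (q < p)%N -> p != q.
Proof. by rewrite -neq_ltn. Qed.

Lemma consecutive_sites i j : val j = i.+1 ->
  [/\ lo j = hi i, val (hi j) = i.+2, hi j != lo i, hi j != hi i &
     forall r : 'I_n.+1, (r < i)%N -> [/\ r != lo i, r != hi i & r != hi j]].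
Proof.
move=> ij; have hij : val (hi j) = i.+2 by rewrite /= ij /bump.
split=> //; first by apply: val_inj; rewrite /= ij /bump.
- by rewrite ord_neq // hij /=; clear; lia.
- by rewrite ord_neq // hij /= /bump /=; clear; lia.
move=> r ri; rewrite !ord_neq // ?hij /= ?/bump /=; move: (val r) (val i) ri; clear; lia.
Qed.

Lemma B_rel_level g : B_rel g -> forall x z, level_ideal x z (g x z).
Proof.
case=> [i j ij|i j ij|i y yi] x z.
- rewrite B0_mulE; apply: gen_sum => y _; apply: genM; rewrite !RgenE.
  have [/RmoveP xy|_] := boolP (Rmove i x y); last by rewrite mul0r; apply: gen0.
  have [/RmoveP yz|_] := boolP (Rmove j y z); last by rewrite mulr0; apply: gen0.
  have [loj hij ji0 ji1 below] := consecutive_sites ij.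
  case: xy yz => x0 x1 y0 y1 xy [y1' y2 z1 z2 yz]; rewrite loj in y1' z1 yz.
  apply: (@far_of_jump x z i (lo i) (hi i) (hi j)) => //.
  - by rewrite xy.
  - by rewrite -yz ?lo_hi // eq_sym.
  by move=> r /below[r0 r1 r2]; rewrite xy ?yz.
- rewrite B0_mulE; apply: gen_sum => y _; apply: genM; rewrite !LgenE.
  have [/LmoveP xy|_] := boolP (Lmove j x y); last by rewrite mul0r; apply: gen0.
  have [/LmoveP yz|_] := boolP (Lmove i y z); last by rewrite mulr0; apply: gen0.
  have [loj hij ji0 ji1 below] := consecutive_sites ij.
  case: xy yz => x2 x1 y2 y1 xy [y1' y0 z1 z0 yz]; rewrite loj in x1 y1 xy.
  apply: level_idealC; apply: (@far_of_jump z x i (lo i) (hi i) (hi j)) => //.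
  - by rewrite -yz.
  - by rewrite xy ?lo_hi // eq_sym.
  by move=> r /below[r0 r1 r2]; rewrite xy ?yz.
rewrite B0_scaleE /f; case: andP => [[/eqP-> /eqP->]|_]; last by rewrite mulr0; apply: gen0.
rewrite mulr1.
have lo_y : lo i \notin val y.
  by apply/negP=> yl; have := in_set0 (lo i); rewrite -yi !inE yl eqxx.
have hi_y : hi i \notin val y.
  by apply/negP=> yh; have := in_set0 (hi i); rewrite -yi !inE yh eqxx orbT.
have := (gapsS y (lo i), gapsS y (hi i)); rewrite lo_y hi_y /= /bump /= !addn1 => -[Y1 Y2].
have i_n : (i.+2 <= n.+1)%N by rewrite !ltnS ltn_ord.
apply: gen_mem; exists (gaps y i.+1).
  have := gaps_mono y i_n (leqnn n.+1); have := gaps_end y.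
  by rewrite [gaps y i.+2]Y2 Y1; move: (gaps y i) (gaps y n.+1); clear; lia.
rewrite /level_mon (big_pred1 i) // => a /=; rewrite andbb.
apply/eqP/eqP=> [ya|-> //]; apply: val_inj => /=.
have [la|la|//] := ltngtP a i.
  have := gaps_mono y la (ltnW (ltnW i_n)); rewrite ya Y1.
  by move: (gaps y i) => b; clear; lia.
have := gaps_mono y (la : i.+2 <= a.+1)%N (leqW (ltn_ord a)); rewrite ya [gaps y i.+2]Y2.
by move: (gaps y i.+1) => b; clear; lia.
Qed.

(** The coefficients of the two-sided ideal of relations are in the ideals of
    levels, as these are stable under the product of [B0]. *)
Lemma rel_ideal_level g : g \in (N : {pred B0 n k}) -> forall x z, level_ideal x z (g x z).
Proof.
move=> /asboolP gN.
pose Q : {pred B0 n k} := fun h => `[<forall x z, level_ideal x z ((h : B0 n k) x z)>].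
have Qcl : ideal_closed Q.
  split=> [|h h' /asboolP h'Q]; first split.
  - by apply/asboolP=> x z; apply: gen0.
  - move=> h h' /asboolP hQ /asboolP h'Q; apply/asboolP=> x z.
    exact: (genB (hQ x z) (h'Q x z)).
  split; apply/asboolP=> x z; rewrite B0_mulE; apply: gen_sum => y _.
    by rewrite mulrCA; apply/genM/level_ideal_mull/h'Q.
  by rewrite mulrA; apply/genMr/level_ideal_mulr/h'Q.
by have /asboolP := gN (Ideal Qcl) (fun h rh => asboolT (B_rel_level rh)).
Qed.

(** A path that takes the heights [c0], [c1] at [b], [b + 1], is below [h] before
    and above [h] after, and subject to this stays as close as possible to the
    region between the paths of [x] and [y]. *)
Definition detour x y (h : nat) b c0 c1 a : nat :=
  if (a < b)%N then minn (maxn (gaps x a) (gaps y a)) h.-1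
  else if a == b then c0 else if a == b.+1 then c1
  else maxn (minn (gaps x a) (gaps y a)) h.+1.

Lemma detour_state x y (h : nat) b c0 c1 : (0 < h <= n - k)%N -> (0 < b <= n)%N ->
  gaps x b = h -> (h.-1 <= c0 <= h)%N -> (c0 <= c1 <= c0.+1)%N -> (h <= c1 <= h.+1)%N ->
  (c1 = h.+1 \/ (gaps y b.+1 <= h)%N) -> (b.+1 = n.+1 -> c1 = h.+1) ->
  exists s, forall a, (a <= n.+1)%N -> gaps s a = detour x y h b c0 c1 a.
Proof.
move=> hk bn xb c0h c01 c1h yb bend; apply: state_of_path.
- by rewrite /detour ifT ?(gaps0 x) ?(gaps0 y) ?max0n ?min0n //; lia.
- have xe := gaps_end x; have ye := gaps_end y; rewrite /detour ifN; last by lia.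
  rewrite ifN; last by lia.
  case: eqP => [E|_]; last by lia.
  by rewrite (bend (esym E)); have := gaps_step x (_ : b <= n)%N; rewrite xb -E; lia.
move=> a an; have := gaps_step x an; have := gaps_step y an.
rewrite /detour.
have [lt_ab|lt_ba|->] := ltngtP a b.
- case: (ltngtP a.+1 b) => [_|| E]; [lia | lia | ].
  by move: xb; rewrite -E => ->; lia.
- have [-> -> ->] : [/\ (a.+1 < b)%N = false, (a.+1 == b) = false & (a.+1 == b.+1) = false].
    by split; lia.
  case: (a =P b.+1) => [E|_]; last by lia.
  have b_n : (b <= n)%N by lia.
  by rewrite -E in yb; have := gaps_step x b_n; rewrite -E; lia.
have [-> ->] : (b.+1 < b)%N = false /\ (b.+1 == b) = false by split; lia.
by rewrite eqxx; lia.
Qed.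

End Relations.

Section LevelMonomials.
Variables n k : nat.
Local Notation P := (zpoly n).
Local Notation V := (V n k).
Local Notation N := (ideal_gen (@B_rel n k)).
Implicit Types (x y z s t m : V) (a b h : nat) (i j : 'I_n).

Lemma scale_B0l (c : P) (g g' : B0 n k) : (c *: g) * g' = c *: (g * g').
Proof. by rewrite -!B0_scalarl mulrA. Qed.
Lemma scale_B0r (c : P) (g g' : B0 n k) : g * (c *: g') = c *: (g * g').
Proof. by rewrite -!B0_scalarr mulrA. Qed.

(** If both paths are at height [h] at [b], detour through a state [s] that is
    at height [h] at [b] only: there [U_b] kills [f_{s,s}]. *)
Lemma level_mon_meet x y h b : (0 < h <= n - k)%N -> (0 < b <= n)%N ->
  gaps x b = h -> gaps y b = h -> level_mon x y h *: f x y \in (N : {pred B0 n k}).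
Proof.
move=> hk bn xb yb; have b_n : (b <= n.+1)%N by lia.
have [|||||s sE] := @detour_state n k x y h b h h.+1 hk bn xb; try lia.
have i_n : (b.-1 < n)%N by lia.
pose i := Ordinal i_n; have iS : i.+1 = b by rewrite /= prednK //; lia.
have gap_i : gaps s b = h by rewrite sE // /detour ltnn eqxx.
have gap_l : gaps s b.-1 = h.-1.
  have := gaps_step x (ltnW i_n); rewrite prednK ?xb; last by lia.
  by rewrite sE ?/detour; last lia; rewrite ifT; lia.
have gap_r : gaps s b.+1 = h.+1.
  by rewrite sE ?ltnS ?/detour; [rewrite ltnNge leqnSn eqxx ifN; lia | lia].
have [q ->] : exists q, level_mon x y h = q * (gmon x s y * 'X_i).
  rewrite level_monE.
  have Xi : 'X_i = \prod_(a < n) 'X_a ^+ (a == i) :> P.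
    by rewrite (bigD1 i) //= eqxx expr1 big1 ?mulr1 // => a /negPf->.
  rewrite Xi /gmon -big_split /=; under [in X in exists q, _ = q * X]eq_bigr do rewrite -exprD.
  eexists; apply: mon_dvd => a.
  have a_n : (a.+1 <= n.+1)%N by rewrite ltnS ltnW.
  have := sE _ a_n; rewrite /detour -val_eqE /=.
  have [lt_a|lt_a|a_b] := ltngtP a.+1 b.
  - have -> : (a == b.-1 :> nat) = false by lia.
    have := gaps_mono x (ltnW lt_a) b_n; have := gaps_mono y (ltnW lt_a) b_n.
    rewrite xb yb => /andP[ya _] /andP[xa _] sa; rewrite addn0.
    have [Ea|Ea] := boolP ((gaps x a.+1 == h) && (gaps y a.+1 == h)).
      by case/andP: Ea => /eqP Ex /eqP Ey; apply: gdeg_off_by_one; rewrite ?sa ?Ex ?Ey; lia.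
    by rewrite gdeg_between // sa; lia.
  - have -> : (a == b.-1 :> nat) = false by lia.
    have := gaps_mono x (ltnW lt_a) a_n; have := gaps_mono y (ltnW lt_a) a_n.
    rewrite xb yb => /andP[ya _] /andP[xa _] sa; rewrite addn0.
    have {}sa : gaps s a.+1 = maxn (minn (gaps x a.+1) (gaps y a.+1)) h.+1.
      rewrite sa; case: eqP => // ab1.
      by have := gaps_step x (_ : b <= n)%N; rewrite xb -ab1; lia.
    have [Ea|Ea] := boolP ((gaps x a.+1 == h) && (gaps y a.+1 == h)).
      by case/andP: Ea => /eqP Ex /eqP Ey; apply: gdeg_off_by_one; rewrite ?sa ?Ex ?Ey; lia.
    by rewrite gdeg_between // sa; lia.
  move=> sa; rewrite gdeg_between ?sa a_b ?xb ?yb ?eqxx //; last by lia.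
  by case: (_ == _).
have relU : 'X_i *: f s s \in (N : {pred B0 n k}).
  apply/rel_ideal_gen/B_rel_U/setP=> p; rewrite !inE.
  apply/negP=> /andP[ps /orP[]/eqP pE]; move: ps; rewrite in_state pE /= ?/bump /=.
    by rewrite prednK ?gap_i ?gap_l; lia.
  by rewrite add1n prednK ?gap_r ?gap_i; lia.
rewrite -scalerA; apply: rel_idealZ.
suff -> : (gmon x s y * 'X_i) *: f x y = f x s * ('X_i *: f s s) * f s y.
  by apply/rel_idealMr/rel_idealMl.
by rewrite scale_B0r scale_B0l f_mul gmonzz scale1r f_mul scalerA mulrC.
Qed.

Lemma moved_of_gaps x y i : (forall a, (a <= n.+1)%N -> a != i.+1 -> gaps x a = gaps y a) ->
  gaps x i.+1 = gaps x i -> gaps x i.+2 = (gaps x i).+1 -> gaps y i.+1 = (gaps x i).+1 ->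
  moved (lo i) (hi i) x y.
Proof.
move=> xy x1 x2 y1; have i_n := ltn_ord i.
have [i_neq i2_neq] : i != i.+1 :> nat /\ i.+2 != i.+1 by split; lia.
have [i_le i2_le] : (i <= n.+1)%N /\ (i.+2 <= n.+1)%N by split; lia.
have y0 := xy _ i_le i_neq; have y2 := xy _ i2_le i2_neq.
split; rewrite ?in_state /= ?/bump /= ?add1n; try by lia.
move=> r; rewrite -!val_eqE /= /bump /= add1n => r0 r1; rewrite !in_state.
by rewrite !xy // ltnW.
Qed.

Lemma moved_inj (p q : 'I_n.+1) x y z : p != q -> moved p q x y -> moved p q x z -> y = z.
Proof. by move=> pq /(movedP _ _ pq)[_ yE] /(movedP _ _ pq)[_ zE]; apply: val_inj; rewrite yE. Qed.

(** Multiplying by [f x s] on the left selects from [Rgen] or [Lgen] the only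
    summand that starts at [s]. *)
Lemma f_sum_f (M : rel V) x s m : M s m -> (forall t, M s t -> t = m) ->
  f x s * (\sum_(p : V * V | M p.1 p.2) f p.1 p.2) = f x s * f s m :> B0 n k.
Proof.
move=> sm uniq_m; rewrite mulr_sumr (bigD1 (s, m)) //= big1 ?addr0 //.
case=> t t' /= /andP[tt']; case: (eqVneq s t) => [st|st] ne; last by rewrite f_mul0.
by move: tt' ne; rewrite -st => /uniq_m->; rewrite eqxx.
Qed.

Lemma f_Rgen x s m i : moved (lo i) (hi i) s m -> f x s * Rgen i = f x s * f s m :> B0 n k.
Proof.
move=> sm; apply: (@f_sum_f (Rmove i)); first exact/RmoveP.
by move=> t /RmoveP st; apply: moved_inj st sm; apply: lo_hi.
Qed.

Lemma f_Lgen x s m i : moved (hi i) (lo i) s m -> f x s * Lgen i = f x s * f s m :> B0 n k.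
Proof.
move=> sm; apply: (@f_sum_f (Lmove i)); first exact/LmoveP.
by move=> t /LmoveP st; apply: moved_inj st sm; rewrite eq_sym lo_hi.
Qed.

Lemma movedC (p q : 'I_n.+1) x y : moved p q x y -> moved q p y x.
Proof. by case=> px qx py qy xy; split=> // r rq rp; rewrite xy. Qed.

Lemma f_mul_between x y z :
  (forall a, (0 < a <= n)%N ->
     (minn (gaps x a) (gaps z a) <= gaps y a <= maxn (gaps x a) (gaps z a))%N) ->
  f x y * f y z = f x z.
Proof. by move=> btw; rewrite f_mul gmon_between ?scale1r. Qed.

Lemma f_mul_betweenC x y z :
  (forall a, (0 < a <= n)%N ->
     (minn (gaps x a) (gaps z a) <= gaps y a <= maxn (gaps x a) (gaps z a))%N) ->
  f z y * f y x = f z x.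
Proof. by move=> btw; apply: f_mul_between => a an; rewrite minnC maxnC btw. Qed.

(** If [x] leaves height [h] at [b] before [y] reaches it, then between the two
    paths there is room for a particle jumping from site [b + 1] to [b - 1]. *)
Lemma f_jump x y h b : (0 < h <= n - k)%N -> (0 < b < n)%N ->
  gaps x b = h -> gaps x b.+1 = h.+1 -> (gaps y b < h)%N ->
  f x y \in (N : {pred B0 n k}) /\ f y x \in (N : {pred B0 n k}).
Proof.
move=> hk bn xb xb1 yb.
have [b_n b_n1 b_n2] : [/\ (0 < b <= n)%N, (b <= n.+1)%N & (b.+1 <= n.+1)%N] by split; lia.
have yb1 : (gaps y b.+1 <= h)%N by have := gaps_step y (_ : b <= n)%N; lia.
have [|||||s sE] := @detour_state n k x y h b h h.+1 hk b_n xb; try lia.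
have [|||||m mE] := @detour_state n k x y h b h h hk b_n xb; try lia.
have [|||||t tE] := @detour_state n k x y h b h.-1 h hk b_n xb; try lia.
have i_n : (b.-1 < n)%N by lia.
have j_n : (b < n)%N by lia.
pose i := Ordinal i_n; pose j := Ordinal j_n.
have ij : val j = i.+1 by rewrite /= prednK //; lia.
have iS : b.-1.+1 = b by lia.
have bF : (b.+1 == b) = false /\ (b.+1 < b)%N = false by split; lia.
have neq_detour c0 c0' c1 c1' a : (a == b -> c0 = c0') -> (a == b.+1 -> c1 = c1') ->
    detour x y h b c0 c1 a = detour x y h b c0' c1' a.
  by rewrite /detour; do 3?case: ifP => // _; move=> // e0 e1; auto.
have atb c0 c1 : detour x y h b c0 c1 b = c0 by rewrite /detour ltnn eqxx.
have atb1 c0 c1 : detour x y h b c0 c1 b.+1 = c1 by rewrite /detour bF.2 bF.1 eqxx.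
have bl := gaps_step x (ltnW i_n); rewrite iS xb in bl.
have yl := gaps_step y (ltnW i_n); rewrite iS in yl.
have atl c0 c1 : detour x y h b c0 c1 b.-1 = h.-1.
  by rewrite /detour ifT; lia.
have atr c0 c1 : detour x y h b c0 c1 b.+2 = h.+1.
  rewrite /detour ifN; last lia; rewrite ifN; last lia; rewrite ifN; last lia.
  by have := gaps_step y (_ : b.+1 <= n)%N; lia.
have sm : moved (hi j) (lo j) s m.
  apply: movedC; apply: moved_of_gaps; rewrite /= ?sE ?mE ?atb ?atb1 ?atr //; try lia.
  by move=> a an ab; rewrite sE // mE //; apply: neq_detour => // /eqP E; rewrite E eqxx in ab.
have mt : moved (hi i) (lo i) m t.
  apply: movedC; apply: moved_of_gaps; rewrite /= ?iS ?mE ?tE ?atb ?atb1 ?atl //; try lia.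
  by move=> a an ab; rewrite tE // mE //; apply: neq_detour => // E; rewrite E in ab.
have below a : (a < b)%N -> (gaps x a <= h)%N /\ (gaps y a <= h.-1)%N.
  move=> ab; have := gaps_mono x (ltnW ab) b_n1; have := gaps_mono y (ltnW ab) b_n1.
  by rewrite xb; lia.
have above a : (b.+1 < a <= n)%N -> (h.+1 <= gaps x a)%N.
  move=> ab; have := gaps_mono x (_ : b.+1 <= a)%N (_ : a <= n.+1)%N; rewrite xb1; lia.
have btw c0 c1 a : (0 < a <= n)%N -> (h.-1 <= c0 <= h)%N -> (h <= c1 <= h.+1)%N ->
  (minn (gaps x a) (gaps y a) <= detour x y h b c0 c1 a <= maxn (gaps x a) (gaps y a))%N.
  move=> an c0h c1h; rewrite /detour; case: ltngtP => [/below[] | ab | ->]; [lia | | lia].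
  by case: eqP => [->|ne]; [|have := above a]; lia.
have xsy a : (0 < a <= n)%N ->
    (minn (gaps x a) (gaps y a) <= gaps s a <= maxn (gaps x a) (gaps y a))%N.
  by move=> an; rewrite sE ?btw; lia.
have smy a : (0 < a <= n)%N ->
    (minn (gaps s a) (gaps y a) <= gaps m a <= maxn (gaps s a) (gaps y a))%N.
  move=> an; have [->|ne] := eqVneq a b.+1; first by rewrite sE // mE // !atb1; lia.
  rewrite (_ : gaps m a = gaps s a); first lia.
  by rewrite sE ?mE; [apply: neq_detour => // E; rewrite E in ne | lia | lia].
have mty a : (0 < a <= n)%N ->
    (minn (gaps m a) (gaps y a) <= gaps t a <= maxn (gaps m a) (gaps y a))%N.
  move=> an; have [->|ne] := eqVneq a b; first by rewrite tE // mE // !atb; lia.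
  rewrite (_ : gaps t a = gaps m a); first lia.
  by rewrite tE ?mE; [apply: neq_detour => // E; rewrite E in ne | lia | lia].
split.
  have -> : f x y = f x s * (Lgen j * Lgen i) * f t y.
    rewrite mulrA (f_Lgen _ sm) -[f x s * _ * Lgen i]mulrA (f_Lgen _ mt).
    by rewrite -!mulrA (f_mul_between mty) (f_mul_between smy) (f_mul_between xsy).
  by apply/rel_idealMr/rel_idealMl/rel_ideal_gen/B_rel_LL.
have -> : f y x = f y t * (Rgen i * Rgen j) * f s x.
  rewrite mulrA (f_Rgen _ (movedC mt)) -[f y t * _ * Rgen j]mulrA (f_Rgen _ (movedC sm)).
  by rewrite !mulrA (f_mul_betweenC mty) (f_mul_betweenC smy) (f_mul_betweenC xsy).
by apply/rel_idealMr/rel_idealMl/rel_ideal_gen/B_rel_RR.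
Qed.

Lemma last_at_height x h : (0 < h <= n - k)%N ->
  exists b, [/\ (0 < b <= n)%N, gaps x b = h & gaps x b.+1 = h.+1].
Proof.
move=> hk; have xe := gaps_end x.
have [|a|b /andP[bn xb] max_b] := @ex_maxnP (fun a => (a <= n.+1)%N && (gaps x a <= h)%N) n.+1.
- by exists 0%N; rewrite gaps0.
- by case/andP.
have b_n : (b <= n)%N.
  by rewrite -ltnS ltn_neqAle bn andbT; apply: contraTneq xb => ->; lia.
have lt_b : (h < gaps x b.+1)%N.
  by rewrite ltnNge; apply/negP=> le_h; have := max_b b.+1; rewrite le_h ltnS b_n ltnn => /(_ isT).
have bs := gaps_step x b_n; exists b; split; try lia.
by rewrite b_n andbT lt0n; apply/eqP=> b0; have := gaps0 x; rewrite b0 in lt_b bs; lia.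
Qed.

(** Whichever path leaves height [h] first, at [b] say: the other path is then
    either at height [h], where [level_mon_meet] applies, or still below it,
    where [f_jump] does. *)
Lemma level_mon_relation x y h : (0 < h <= n - k)%N ->
  level_mon x y h *: f x y \in (N : {pred B0 n k}).
Proof.
move=> hk.
have [b [bn xb xb1]] := last_at_height x hk.
have [c [cn yc yc1]] := last_at_height y hk.
have [bn1 cn1] : (b <= n.+1)%N /\ (c <= n.+1)%N by split; lia.
have [le_bc|/ltnW le_cb] := leqP b c.
  have [yb|yb] := eqVneq (gaps y b) h; first exact: (level_mon_meet hk bn xb yb).
  have yc_b := gaps_mono y le_bc cn1; rewrite yc in yc_b.
  have b_ltn : (0 < b < n)%N by move: yb yc_b; case: (eqVneq b c) => [->|]; lia.
  by apply: rel_idealZ; apply: (f_jump hk b_ltn xb xb1 _).1; lia.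
have [xc|xc] := eqVneq (gaps x c) h; first exact: (level_mon_meet hk cn xc yc).
have xb_c := gaps_mono x le_cb bn1; rewrite xb in xb_c.
have c_ltn : (0 < c < n)%N by move: xc xb_c; case: (eqVneq b c) => [<-|]; lia.
by apply: rel_idealZ; apply: (f_jump hk c_ltn yc yc1 _).2; lia.
Qed.

End LevelMonomials.

(** * Sartori's ideals modulo elementary symmetric polynomials *)

Section HomIdeal.
Variables n k : nat.
Local Notation P := (zpoly n).
Local Notation V := (V n k).
Implicit Types (x y : V) (a l d : nat) (i : 'I_n) (p q : P).

(** Pigeonhole. A set [S] of positions above [l] that omits, at each of the
    heights from [minn (gaps x l) (gaps y l) + 1] to [n - k], a position where both
    paths are at that height has at most [minn (v x l) (v y l)] elements. The
    monomial of a larger set is thus a multiple of some [level_mon x y h]. *)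
Lemma esuf_level x y l d : (l <= n)%N -> (minn (v x l) (v y l) < d)%N ->
  level_ideal x y (esuf n d l).
Proof.
move=> ln vd; apply: gen_sum => S /andP[/eqP Sd /forall_inP Sl].
pose level h i := (gaps x i.+1 == h) && (gaps y i.+1 == h).
pose C := [set i : 'I_n | (l <= i)%N] :\: S.
have [/existsP[h /andP[hk /forallP hS]]|] := boolP [exists h : 'I_n.+1,
    (0 < h <= n - k)%N && [forall i, level h i ==> (i \in S)]].
  rewrite (bigID (level h)) /= mulrC; apply: genM; apply: gen_mem; exists h => //.
  apply: eq_bigl => i; rewrite andb_idl // => hi.
  by have := hS i; rewrite [level h i]hi.
move=> /existsPn noh.
(* suppose that [S] omits a position from each height *)
have lvl h : (0 < h <= n - k)%N -> exists2 i, i \notin S & level h i.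
  move=> hk; have hn : (h < n.+1)%N by lia.
  have := noh (Ordinal hn); rewrite /= hk /= => /forallPn[i].
  by rewrite negb_imply => /andP[hi iS]; exists i.
pose z a := minn (gaps x a) (gaps y a).
have zl_h h i : (z l < h)%N -> level h i -> (l <= i)%N.
  rewrite /z => zh /andP[/eqP xi /eqP yi]; rewrite leqNgt; apply/negP=> il.
  have := gaps_mono x il (leqW ln); have := gaps_mono y il (leqW ln).
  by rewrite xi yi; lia.
have leC : (n - k - z l <= #|C|)%N.
  have -> : (n - k - z l)%N = size (iota (z l).+1 (n - k - z l)) by rewrite size_iota.
  rewrite cardE -(size_map (fun i : 'I_n => gaps x i.+1)).
  apply: uniq_leq_size => [|h]; first exact: iota_uniq.
  rewrite mem_iota => hz; have [|i iS hi] := lvl h; first by lia.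
  apply/mapP; exists i; last by case/andP: hi => /eqP.
  by rewrite mem_enum !inE iS (zl_h h) //; lia.
have leT : (#|[set i : 'I_n | (l <= i)%N]| <= n - l)%N.
  rewrite -(size_iota l (n - l)) cardE -(size_map val).
  apply: uniq_leq_size => [|a /mapP[i]]; first by rewrite (map_inj_uniq val_inj) enum_uniq.
  by rewrite mem_enum inE mem_iota subnKC // => li ->; rewrite li ltn_ord.
have SC : (#|S| + #|C| = #|[set i : 'I_n | (l <= i)%N]|)%N.
  rewrite -(cardsID S [set i : 'I_n | (l <= i)%N]); congr (_ + _)%N.
  by apply: eq_card => i; rewrite !inE andb_idl // => /Sl.
have := vE x (leqW ln); have := vE y (leqW ln).
by move: leC leT SC vd; rewrite Sd /z; clear; lia.
Qed.

Definition hom_gens x y : P -> Prop :=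
  fun p => level_gens x y p \/ exists2 d, (0 < d <= k)%N & p = mesym n int d.

(** For left states, the common annihilator of [f_{x,y}] in the quotient of the
    Ozsvath-Szabo algebra by [e_1, ..., e_k], and of the class of [1 |-> x^c]
    in the Sartori algebra. *)
Definition hom_ideal x y := in_gen (hom_gens x y).

Lemma level_hom_ideal x y p : level_ideal x y p -> hom_ideal x y p.
Proof. by apply: gen_sub => s ls; apply: gen_mem; left. Qed.

(** Beyond degree [k] this is the case [l = 0] of [esuf_level]. *)
Lemma mesym_hom_ideal x y d : hom_ideal x y (mesym n int d.+1).
Proof.
have [dk|dk] := leqP d.+1 k; first by apply: gen_mem; right; exists d.+1.
apply: level_hom_ideal; rewrite -esuf_mesym; apply: esuf_level => //.
by have := vE x (leq0n n.+1); rewrite gaps0; lia.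
Qed.

Lemma path_min_hom_ideal x y p :
  path_ideal (fun a => minn (v x a) (v y a)) p -> hom_ideal x y p.
Proof.
apply: gen_sub => _ [i _ ->]; set d := (_).+1.
have := hsym_mod_esuf d (ltn_ord i) (mesym_hom_ideal x y).
move=> gapS; rewrite -[hsym n d i.+1](subrK ((-1) ^+ d * esuf n d i.+1)).
apply: genD gapS _; apply/genM/level_hom_ideal/esuf_level => //.
Qed.

Lemma left_lattice_path x : ord_max \notin val x -> lattice_path n (v x).
Proof.
move=> x_left; split=> [|a an].
  have := vE x (leqnSn n); have := gaps_end x; have := gapsS x ord_max.
  by rewrite x_left /=; lia.
have an1 : (a <= n.+1)%N by lia.
have := gaps_step x (ltnW an); have := vE x an1; have := vE x (leqW an).
lia.
Qed.

Lemma mesym_path_ideal x d : ord_max \notin val x -> path_ideal (v x) (mesym n int d.+1).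
Proof.
move=> x_left; apply: mesym_mod_hsym => {}d; apply: hsym_path_ideal => //.
  exact: left_lattice_path.
by have [-> _] := left_lattice_path x_left.
Qed.

Section LeftStates.
Variables x y : V.
Hypotheses (x_left : ord_max \notin val x) (y_left : ord_max \notin val y).

Let vmin a := minn (v x a) (v y a).

Let v0 : v x 0 = vmin 0.
Proof. by rewrite /vmin; have := vE x (leq0n n.+1); have := vE y (leq0n n.+1); rewrite !gaps0; lia. Qed.

Let vmin_path : lattice_path n vmin.
Proof.
have [xn xs] := left_lattice_path x_left; have [yn ys] := left_lattice_path y_left.
split=> [|a an]; first by rewrite /vmin xn yn.
by have := xs a an; have := ys a an; rewrite /vmin; lia.
Qed.

Let Xi_mon_min : Xi_mon x y = path_mon n (v x) vmin.
Proof. by apply: eq_bigr => i _; rewrite /vmin; congr (_ ^+ _); lia. Qed.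

Let colon := path_colon (left_lattice_path x_left) vmin_path v0 (fun a _ => geq_minl (v x a) (v y a)).

Lemma Xi_mon_hom p : path_ideal (v y) p -> path_ideal (v x) (Xi_mon x y * p).
Proof.
move=> py; rewrite Xi_mon_min; apply/colon.1; apply: path_ideal_le vmin_path _ _ py.
by move=> a _; apply: geq_minr.
Qed.

Lemma Xi_mon_ker p : path_ideal (v x) (Xi_mon x y * p) -> hom_ideal x y p.
Proof. by rewrite Xi_mon_min => /colon.1/path_min_hom_ideal. Qed.

(** A polynomial that maps the ideal of [y] into that of [x] also maps the ideal
    of the minimum of the two paths there, because each generator of the latter
    is a generator of one of the former. *)
Lemma Xi_mon_gen p : (forall s, path_ideal (v y) s -> path_ideal (v x) (p * s)) ->
  exists q, path_ideal (v x) (p - Xi_mon x y * q).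
Proof.
move=> pyx; rewrite Xi_mon_min; apply: colon.2.
apply: gen_ind; first exact: colon_closed.
move=> _ [i _ ->]; rewrite /vmin /minn; case: ifP => _.
  exact/genM/path_ideal_gen.
exact/pyx/path_ideal_gen.
Qed.

End LeftStates.

Lemma hom_ideal_mulr x y z p : hom_ideal x y p -> hom_ideal x z (gmon x y z * p).
Proof.
move: p; apply: gen_ind => [|s [ls|[d dk ->]]]; first exact: colon_closed.
  by apply/level_hom_ideal/level_ideal_mulr/gen_mem.
by apply/genM/gen_mem; right; exists d.
Qed.

Lemma hom_ideal_mull x y z p : hom_ideal y z p -> hom_ideal x z (gmon x y z * p).
Proof.
move: p; apply: gen_ind => [|s [ls|[d dk ->]]]; first exact: colon_closed.
  by apply/level_hom_ideal/level_ideal_mull/gen_mem.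
by apply/genM/gen_mem; right; exists d.
Qed.

End HomIdeal.

(** * Sequences and left states *)

(** Comparing the positions of two states amounts to counting sites, which is how
    the descriptions by positions are translated into heights. *)
Lemma nth_le_count (s : seq nat) j a : sorted ltn s -> (j < size s)%N ->
  (nth 0%N s j <= a)%N = (j < count (leq^~ a) s)%N.
Proof.
elim: s j => // q s IHs j /= qs; have s_sorted := path_sorted qs.
have /allP q_min := order_path_min ltn_trans qs.
have [le_qa|lt_aq] := leqP q a; first by case: j => // j js /=; rewrite IHs.
have -> : count (leq^~ a) s = 0%N.
  apply/eqP; rewrite -leqn0 leqNgt -has_count; apply/hasPn=> r /q_min /= qr.
  by rewrite -ltnNge (ltn_trans lt_aq).
case: j => [|j] js /=; first by rewrite leqNgt lt_aq.
have lt_q : (q < nth 0 s j)%N := q_min _ (mem_nth 0%N js).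
by rewrite leqNgt (ltn_trans lt_aq lt_q).
Qed.

Section Sequences.
Variables n k : nat.
Local Notation P := (zpoly n).
Local Notation V := (V n k).
Local Notation Vl := (Vl n k).
Local Notation D := (D n k).
Local Notation sq := (@seq_of_state n k).
Implicit Types (x y z : Vl) (a j : nat) (i : 'I_n) (lam mu nu : D).

Lemma nth_wedges x i : nth false (wedges x) i = (lo i \in val (val x)).
Proof. by rewrite -tnth_nth tnth_mktuple. Qed.

Lemma left_state x : ord_max \notin val (val x). Proof. by case: x. Qed.

Lemma gaps_left x : (gaps (val x) n + k = n)%N.
Proof. by have := gapsS (val x) ord_max; have := gaps_end (val x); rewrite left_state /=; lia. Qed.

Lemma seq_of_state_inj : injective sq.
Proof.
move=> x y /(congr1 val)/= xy; do 2!apply: val_inj; apply/setP=> p.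
have [pn|] := ltnP p n; last first.
  move=> np; have -> : p = ord_max by apply: val_inj => /=; have := ltn_ord p; lia.
  by rewrite (negPf (left_state x)) (negPf (left_state y)).
have -> : p = lo (Ordinal pn) by apply: val_inj.
by rewrite -!nth_wedges xy.
Qed.

(** The cardinality of the set of wedges is obtained by applying [wedgesP] to
    that set, as a state with its own number of elements. *)
Lemma seq_of_state_surj mu : exists x, sq x = mu.
Proof.
pose A := [set p : 'I_n.+1 | nth false (val mu) p].
have Al : ord_max \notin A by rewrite inE nth_default ?size_tuple.
have seqA m (Am : #|A| == m) :
    wedges (exist (fun x : Defs.V n m => ord_max \notin val x)
      (exist (fun x : {set 'I_n.+1} => #|x| == m) A Am) Al) = val mu.
  by apply: eq_from_tnth => i; rewrite tnth_mktuple /= inE (tnth_nth false).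
have Ak : #|A| == k.
  have := wedgesP (exist (fun x : Defs.V n #|A| => ord_max \notin val x)
      (exist (fun x : {set 'I_n.+1} => #|x| == #|A|) A (eqxx _)) Al).
  by rewrite seqA (eqP (valP mu)) eq_sym.
by exists (exist _ (exist _ A Ak) Al); apply: val_inj; rewrite /= seqA.
Qed.

Definition state_of_seq mu : Vl := projT1 (cid (seq_of_state_surj mu)).

Lemma state_of_seqK mu : sq (state_of_seq mu) = mu.
Proof. exact: projT2 (cid (seq_of_state_surj mu)). Qed.

Lemma seq_of_stateK x : state_of_seq (sq x) = x.
Proof. by apply: seq_of_state_inj; rewrite state_of_seqK. Qed.

Lemma bseq_state x a : (a <= n)%N -> Defs.bseq (sq x) a = (v (val x) a).+1.
Proof.
move=> an; congr _.+1; rewrite -(subKn an).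
elim: (n - a)%N (leq_subr a n) => [|c IHc] cn.
  rewrite subn0 drop_oversize ?size_tuple // [count _ _]/=.
  by have := vE (val x) (leqnSn n); have := gaps_left x; lia.
have lt_n : (n - c.+1 < n)%N by lia.
have := IHc (ltnW cn); rewrite -(subnSK cn) (@drop_nth _ false (n - c.+1)%N) ?size_tuple //.
rewrite [count _ (_ :: _)]/= => ->; rewrite (nth_wedges x (Ordinal lt_n)).
have := gapsS (val x) (lo (Ordinal lt_n)); rewrite [nat_of_ord _]/=.
have := vE (val x) (ltnW (leqW lt_n)); have := vE (val x) (leqW lt_n).
by case: (_ \in _); rewrite [nat_of_bool _]/=; lia.
Qed.

Lemma vees_sorted mu : sorted ltn (vees mu).
Proof.
rewrite sorted_map; apply: sorted_filter; last exact: iota_ltn_sorted.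
exact: ltn_trans.
Qed.

Lemma count_vees x a : (a <= n)%N -> count (leq^~ a) (vees (sq x)) = gaps (val x) a.
Proof.
move=> an; rewrite count_map count_filter.
rewrite -[n in iota _ n](subnKC an) iotaD count_cat addnC -[RHS]add0n; congr (_ + _)%N.
  apply/eqP; rewrite -leqn0 leqNgt -has_count; apply/hasPn=> c; rewrite mem_iota /=.
  by rewrite negb_and -leqNgt => /andP[->].
rewrite (@eq_in_count _ _ (fun c => ~~ nth false (wedges x) c)) => [|c]; last first.
  by rewrite mem_iota add0n /= => ->.
elim: a an => [|a IHa] an; first by rewrite gaps0.
rewrite -addn1 iotaD count_cat IHa ?(ltnW an) //= addn0 (nth_wedges x (Ordinal an)) addn1.
by rewrite (gapsS (val x) (lo (Ordinal an))).
Qed.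

Lemma size_vees x : size (vees (sq x)) = (n - k)%N.
Proof.
rewrite -(count_predT (vees _)) -(_ : gaps (val x) n = (n - k)%N); last first.
  by have := gaps_left x; lia.
rewrite -(count_vees x (leqnn n)); apply: eq_in_count => c.
by case/mapP=> i; rewrite mem_filter mem_iota add0n => /andP[_ lt_in] ->.
Qed.

Lemma vee_le x j a : (0 < j <= n - k)%N -> (a <= n)%N ->
  (vee (sq x) j <= a)%N = (j <= gaps (val x) a)%N.
Proof.
move=> jk an; rewrite /vee nth_le_count; [|exact: vees_sorted | by rewrite size_vees; lia].
by rewrite count_vees //; lia.
Qed.

Lemma level_interval x y j i : (0 < j <= n - k)%N ->
  (alpha (sq y) (sq x) j <= i.+1 <= beta (sq y) (sq x) j)%N =
  (gaps (val x) i.+1 == j) && (gaps (val y) i.+1 == j).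
Proof.
move=> jk; have i_n := ltn_ord i; rewrite /alpha /beta geq_max !vee_le //.
have := gaps_mono (val x) i_n (leqnSn n); have := gaps_mono (val y) i_n (leqnSn n).
have := gaps_left x; have := gaps_left y; case: (ltnP j (n - k)) => [lt_j|]; last by lia.
have := @vee_le x j.+1 i.+1 lt_j i_n; have := @vee_le y j.+1 i.+1 lt_j i_n.
by move: (vee _ _) (vee _ _) => c d; lia.
Qed.

Lemma W_monE x y j : (0 < j <= n - k)%N ->
  W_mon (sq y) (sq x) j = level_mon (val x) (val y) j * Xi_mon (val x) (val y).
Proof.
move=> jk; congr (_ * _); first by apply: eq_bigl => i; rewrite level_interval.
by apply: eq_bigr => i _; rewrite !bseq_state ?subSS // ltnW.
Qed.

Lemma seq_too_far_level x y : seq_too_far (sq y) (sq x) ->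
  forall p, level_ideal (val x) (val y) p.
Proof.
case/existsP=> j /andP[jk far]; have jk' : (0 < j <= n - k)%N by lia.
have jk1 : (0 < j.+1 <= n - k)%N by lia.
apply: (level_ideal_far jk') => a /andP[_ an] xa ya.
have := (vee_le x jk' an, vee_le y jk' an, vee_le x jk1 an, vee_le y jk1 an).
by rewrite xa ya leqnn ltnn; case=> -[[]]; case/orP: far; lia.
Qed.

Definition sites (A : V) : seq nat := [seq val p | p <- enum (val A)].

Lemma sites_sorted (A : V) : sorted ltn (sites A).
Proof.
apply: (subseq_sorted ltn_trans) (iota_ltn_sorted 0 n.+1).
by rewrite -val_enum_ord enumT /sites; apply: map_subseq; apply: filter_subseq.
Qed.

Lemma count_sites (A : V) a : (a <= n)%N ->
  (count (leq^~ a) (sites A) + gaps A a.+1 = a.+1)%N.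
Proof.
move=> an; have -> : count (leq^~ a) (sites A) = #|[set p in val A | (p <= a)%N]|.
  rewrite count_map cardE -size_filter; congr size.
  by rewrite /enum_mem -filter_predI; apply: eq_filter => p; rewrite /= !inE andbC.
have vA := vE A (an : a.+1 <= n.+1)%N.
have := cardsID [set p : 'I_n.+1 | (p <= a)%N] (val A); rewrite (eqP (valP A)).
have -> : #|val A :\: [set p : 'I_n.+1 | (p <= a)%N]| = v A a.+1.
  by apply: eq_card => p; rewrite !inE -ltnNge andbC.
have -> : val A :&: [set p : 'I_n.+1 | (p <= a)%N] = [set p in val A | (p <= a)%N].
  by apply/setP=> p; rewrite !inE.
move: #|_| vA; clear; lia.
Qed.

(** With [q] the [i]-th element of [A], the paths do not meet at height
    [q + 1 - i]: that of [A] reaches it only after [q + 1], and that of [B] has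
    left it by then. *)
Lemma elt_too_far (A B : V) (i : 'I_k) : ((elt A i).+1 < elt B i)%N ->
  forall p, level_ideal A B p.
Proof.
set q := elt A i => lt_q.
have size_sites (C : V) : size (sites C) = k by rewrite size_map -cardE (eqP (valP C)).
have B_n : (elt B i <= n)%N.
  have : elt B i \in sites B by apply: mem_nth; rewrite size_sites.
  by case/mapP=> p _ ->; apply: (ltn_ord p).
have q_n : (q.+1 <= n)%N by lia.
have := @nth_le_count (sites A) i q (sites_sorted A).
rewrite size_sites leqnn => /(_ (ltn_ord i))/esym count_A.
have := @nth_le_count (sites B) i q.+1 (sites_sorted B).
rewrite size_sites (leqNgt _ q.+1) lt_q => /(_ (ltn_ord i))/esym/negbT count_B.
have sA := count_sites A (ltnW q_n); have sB := count_sites B q_n.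
have ends := gaps_end B; have mono_B := gaps_mono B (q_n : q.+2 <= n.+1)%N (leqnn n.+1).
have hk : (0 < q.+1 - i <= n - k)%N by lia.
apply: (level_ideal_far hk) => a /andP[_ an] Aa Ba.
have [le_a|lt_a] := leqP a q.+1.
  by have := gaps_mono A le_a (ltnW q_n); lia.
by have := gaps_mono B lt_a (leqW an); lia.
Qed.

Lemma too_far_level (A B : V) : too_far A B -> forall p, level_ideal A B p.
Proof.
case/existsP=> i far p.
have [far_l|far_r] : ((elt A i).+1 < elt B i \/ (elt B i).+1 < elt A i)%N by lia.
  exact: elt_too_far far_l p.
by apply/level_idealC/(elt_too_far far_r).
Qed.

End Sequences.

(** * The Hom spaces and the submodules W *)

Section HomSpaces.
Variables n k : nat.
Local Notation P := (zpoly n).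
Local Notation Vl := (Vl n k).
Local Notation D := (D n k).
Local Notation sq := (@seq_of_state n k).
Local Notation hom := (@Defs.hom n k).
Implicit Types (x y z : Vl) (p q r s : P) (lam mu nu : D).

Lemma Ib_state x p : p \in (Ib (sq x) : {pred P^o}) <-> path_ideal (v (val x)) p.
Proof.
rewrite -/(in_gen _ p); split; apply: gen_sub => s.
  by case=> i ->; rewrite bseq_state ?ltn_ord //; apply: path_ideal_gen.
by case=> i _ ->; apply: gen_mem; exists i; rewrite bseq_state.
Qed.

Lemma Rb_piZ lam p q : Rb_pi lam (p * q) = p *: Rb_pi lam q.
Proof. exact: (mod_piZ (Ib lam) p q). Qed.

Lemma Rb_pi_surj lam (u : Rb lam) : exists p, u = Rb_pi lam p.
Proof. by exists (mod_repr u); rewrite /Rb_pi mod_reprK. Qed.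

Lemma Rb_piE lam p q : Rb_pi lam p = Rb_pi lam q <-> p - q \in (Ib lam : {pred P^o}).
Proof. exact: (mod_piE (Ib lam) p q). Qed.

Lemma Rb_pi0 lam : Rb_pi lam 0 = 0. Proof. exact: (mod_pi0 (Ib lam)). Qed.

Lemma Rb_pi_eq0 x p : Rb_pi (sq x) p = 0 <-> path_ideal (v (val x)) p.
Proof.
by rewrite -Ib_state -(Rb_pi0 (sq x)) Rb_piE subr0.
Qed.

Lemma homZ lam mu (phi : hom lam mu) p (u : Rb lam) : phi (p *: u) = p *: phi u.
Proof.
have /asboolP phi_lin := lin_homP phi.
have phi0 : phi 0 = 0.
  by apply: (addrI (phi 0)); have := phi_lin 1 0 0; rewrite !scale1r !addr0.
by have := phi_lin p u 0; rewrite phi0 !addr0.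
Qed.

Lemma hom_ext lam mu (phi psi : hom lam mu) :
  phi (Rb_pi lam 1) = psi (Rb_pi lam 1) -> phi = psi.
Proof.
move=> phipsi; apply: val_inj; apply/funext=> u; have [p ->] := Rb_pi_surj u.
by rewrite /= -[p]mulr1 Rb_piZ !homZ phipsi.
Qed.

Lemma hom_scaleE lam mu (phi : hom lam mu) r (u : Rb lam) : (r *: phi) u = r *: phi u.
Proof. by []. Qed.

Lemma map1_exists lam mu p :
  (forall s, s \in (Ib lam : {pred P^o}) -> s * p \in (Ib mu : {pred P^o})) ->
  exists phi : hom lam mu, is_map1 p phi.
Proof.
move=> pI; pose phi (u : Rb lam) := Rb_pi mu (mod_repr u * p).
have phiE q : phi (Rb_pi lam q) = Rb_pi mu (q * p).
  by apply/Rb_piE; rewrite -mulrBl; apply/pI/Rb_piE; rewrite /Rb_pi mod_reprK.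
have phi_lin : phi \in is_linear (M := Rb lam) (N := Rb mu).
  apply/asboolP=> c u w; have [a ->] := Rb_pi_surj u; have [b ->] := Rb_pi_surj w.
  rewrite -Rb_piZ -[Rb_pi lam _ + _](mod_piD (Ib lam)) !phiE mulrDl -mulrA.
  by rewrite [LHS](mod_piD (Ib mu)) -/(Rb_pi mu _) Rb_piZ.
by exists (LinHom phi_lin); rewrite /is_map1 /= phiE mul1r.
Qed.

Lemma Xi_hom_exists x y :
  exists phi : hom (sq y) (sq x), is_map1 (Xi_mon (val x) (val y)) phi.
Proof.
apply: map1_exists => s /Ib_state sy; apply/Ib_state; rewrite mulrC.
by apply: Xi_mon_hom => //; apply: left_state.
Qed.

Definition Xi_hom x y : hom (sq y) (sq x) := projT1 (cid (Xi_hom_exists x y)).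

Lemma Xi_homE x y : Xi_hom x y (Rb_pi (sq y) 1) = Rb_pi (sq x) (Xi_mon (val x) (val y)).
Proof. exact: projT2 (cid (Xi_hom_exists x y)). Qed.

Lemma Xi_hom_span x y (phi : hom (sq y) (sq x)) : exists r, phi = r *: Xi_hom x y.
Proof.
have [p phi1] := Rb_pi_surj (phi (Rb_pi (sq y) 1)).
have [|q qE] := Xi_mon_gen (left_state x) (left_state y) (p := p).
  move=> s sy; apply/Rb_pi_eq0; rewrite mulrC Rb_piZ -phi1 -homZ -Rb_piZ mulr1.
  have /Rb_pi_eq0-> := sy.
  by rewrite -(scale0r (0 : Rb (sq y))) homZ scale0r.
exists q; apply: hom_ext; rewrite hom_scaleE Xi_homE phi1 -Rb_piZ.
by apply/Rb_piE/Ib_state; rewrite mulrC.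
Qed.

Lemma Xi_hom_ker x y r : r *: Xi_hom x y = 0 -> hom_ideal (val x) (val y) r.
Proof.
move=> r0; apply: (Xi_mon_ker (left_state x) (left_state y)).
apply/Rb_pi_eq0; rewrite mulrC Rb_piZ -Xi_homE -hom_scaleE r0; exact: erefl.
Qed.

Lemma Xi_hom_comp x y z :
  lin_comp (Xi_hom x y) (Xi_hom y z) = gmon (val x) (val y) (val z) *: Xi_hom x z.
Proof.
apply: hom_ext; rewrite hom_scaleE Xi_homE -Rb_piZ /= Xi_homE.
rewrite -[Xi_mon (val y) _]mulr1 Rb_piZ homZ Xi_homE -Rb_piZ; congr (Rb_pi _ _).
rewrite /gmon /Xi_mon -!big_split; apply: eq_bigr => i _ /=; rewrite -!exprD; congr (_ ^+ _).
by have /= := gdegE (val x) (val y) (val z) i.+1; rewrite /vdist; lia.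
Qed.

Definition span_ideal x y : {pred hom (sq y) (sq x)} :=
  fun phi => `[<exists2 r, hom_ideal (val x) (val y) r & phi = r *: Xi_hom x y>].

Arguments span_ideal : clear implicits.

Lemma span_ideal_closed x y : submod_closed (span_ideal x y).
Proof.
split=> [|c _ _ /asboolP[r rI ->] /asboolP[s sI ->]]; apply/asboolP.
  by exists 0; [apply: gen0 | rewrite scale0r].
exists (c * r + s); first by apply: genD => //; apply: genM.
by rewrite scalerDl scalerA.
Qed.

(** For sequences that are not too far, [W] is generated by the multiples of
    [1 |-> x^c] by the [level_mon], and symmetric polynomials already kill this
    map; otherwise [hom_ideal] is the unit ideal, as [W] is everything. *)
Lemma W_Xi_hom x y r :
  r *: Xi_hom x y \in (W (sq y) (sq x) : {pred _}) <-> hom_ideal (val x) (val y) r.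
Proof.
have [far|near] := boolP (seq_too_far (sq y) (sq x)).
  rewrite /W far; split=> // _.
  exact/level_hom_ideal/(seq_too_far_level far).
rewrite /W (negPf near); split=> [/asboolP/(_ (Submod (span_ideal_closed x y)))|].
  have gens phi : (exists2 j, (0 < j <= n - k)%N & is_map1 (W_mon (sq y) (sq x) j) phi) ->
      phi \in (Submod (span_ideal_closed x y) : {pred _}).
    case=> j jk phi1; apply/asboolP; exists (level_mon (val x) (val y) j).
      by apply/level_hom_ideal/gen_mem; exists j.
    by apply: hom_ext; rewrite phi1 hom_scaleE Xi_homE -Rb_piZ W_monE.
  move=> /(_ gens)/asboolP[s sI rsE].
  rewrite -(subrK s r); apply: genD sI.
  by apply: Xi_hom_ker; rewrite scalerBl rsE subrr.
move: r; apply: gen_ind => [|s [[j jk ->]|[d dk ->]]].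
- split=> [|p q pW qW|c p pW]; first by rewrite scale0r rpred0.
    by rewrite scalerDl rpredD.
  by rewrite -scalerA rpredZ.
- apply/asboolP=> N; apply; exists j => //.
  by rewrite /is_map1 hom_scaleE Xi_homE -Rb_piZ W_monE.
suff -> : mesym n int d *: Xi_hom x y = 0 by rewrite rpred0.
apply: hom_ext; rewrite hom_scaleE Xi_homE -Rb_piZ.
have -> : (0 : hom (sq y) (sq x)) (Rb_pi (sq y) 1) = 0 by [].
apply/Rb_pi_eq0/genMr; rewrite -(prednK (proj1 (andP dk))).
exact: mesym_path_ideal (left_state x).
Qed.

Lemma W_is_ideal : W_ideal n k.
Proof.
move=> lam mu nu.
have [x <-] := seq_of_state_surj lam; have [y <-] := seq_of_state_surj mu.
have [z <-] := seq_of_state_surj nu => g h.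
have [r ->] := Xi_hom_span g; have [s ->] := Xi_hom_span h.
rewrite lin_compZl lin_compZr Xi_hom_comp !scalerA => rsW; apply/W_Xi_hom.
case: rsW => /W_Xi_hom rsI.
  by rewrite -mulrA mulrCA; apply/genM; rewrite mulrC; apply: hom_ideal_mulr.
rewrite -mulrA [s * _]mulrC; apply/genM; exact: hom_ideal_mull.
Qed.

End HomSpaces.

(** * The isomorphism *)

(** The first isomorphism theorem. *)
Lemma quotient_isomorphism (R : comPzRingType) (B A : pzAlgType R) (I : ideal B) (Xi : B -> A) :
  alg_morphism Xi -> (forall b, Xi b = 0 <-> b \in (I : {pred B})) ->
  (forall a, exists b, Xi b = a) ->
  exists Xibar : alg_quot I -> A,
    [/\ alg_morphism Xibar, forall b, Xibar (alg_pi I b) = Xi b & bijective Xibar].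
Proof.
move=> [XiB [Xi1 XiM] XiZ] Xi_ker Xi_surj.
pose Xibar (q : alg_quot I) := Xi (repr q).
have XibarE b : Xibar (alg_pi I b) = Xi b.
  apply/eqP; rewrite -subr_eq0 -XiB; apply/eqP/Xi_ker/alg_piE.
  exact: alg_reprK.
have pi_ind (Q : alg_quot I -> Prop) : (forall b, Q (alg_pi I b)) -> forall q, Q q.
  by move=> Qpi q; rewrite -[q]alg_reprK.
exists Xibar; split=> //.
  split; first by elim/pi_ind=> a; elim/pi_ind=> b; rewrite -alg_piN -alg_piD !XibarE.
    split; first by rewrite XibarE Xi1.
    by elim/pi_ind=> a; elim/pi_ind=> b; rewrite -[_ * _]alg_piM !XibarE.
  by move=> c; rewrite XibarE XiZ.
exists (fun a => alg_pi I (projT1 (cid (Xi_surj a)))) => [|a]; last first.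
  by rewrite XibarE; case: cid.
elim/pi_ind=> b; rewrite XibarE; case: cid => c /= cb.
by apply/alg_piE/Xi_ker; rewrite XiB cb subrr.
Qed.

Section Isomorphism.
Variables n k : nat.
Local Notation P := (zpoly n).
Local Notation V := (V n k).
Local Notation Vl := (Vl n k).
Local Notation D := (D n k).
Local Notation sq := (@seq_of_state n k).
Local Notation st := (@state_of_seq n k).
Local Notation hom := (@Defs.hom n k).
Local Notation N := (ideal_gen (@B_rel n k)).
Local Notation piB := (alg_pi N).
Local Notation A := (sartori (@W_is_ideal n k)).
Implicit Types (x y z : Vl) (p q r s : P) (lam mu nu : D) (c : Vl -> Vl -> P).

(** A sequence is only propositionally equal to that of its state, so generators
    indexed by sequences are obtained from those indexed by states by choice. *)
Lemma gen_exists lam mu : exists phi : qhom lam mu,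
  exists2 psi : hom lam mu, is_map1 (Xi_mon (val (st mu)) (val (st lam))) psi & phi = qhom_pi psi.
Proof.
have [x <-] := seq_of_state_surj mu; have [y <-] := seq_of_state_surj lam.
rewrite !seq_of_stateK; exists (qhom_pi (Xi_hom x y)).
by exists (Xi_hom x y) => //; apply: Xi_homE.
Qed.

Definition qgen lam mu : qhom lam mu := projT1 (cid (gen_exists lam mu)).

Lemma qgenE x y : qgen (sq y) (sq x) = qhom_pi (Xi_hom x y).
Proof.
rewrite /qgen; case: cid => /= _ [psi psi1 ->]; congr qhom_pi; apply: hom_ext.
by rewrite psi1 !seq_of_stateK Xi_homE.
Qed.

Lemma qgen_span lam mu (t : qhom lam mu) : exists r, t = r *: qgen lam mu.
Proof.
have [x Ex] := seq_of_state_surj mu; have [y Ey] := seq_of_state_surj lam.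
subst mu lam; elim/qhom_ind: t => h; have [r ->] := Xi_hom_span h.
by exists r; rewrite qgenE; apply: mod_piZ.
Qed.

Lemma qgen_ker lam mu r : r *: qgen lam mu = 0 <-> hom_ideal (val (st mu)) (val (st lam)) r.
Proof.
have [x <-] := seq_of_state_surj mu; have [y <-] := seq_of_state_surj lam.
rewrite !seq_of_stateK qgenE -W_Xi_hom -[in X in _ <-> X](subr0 (r *: Xi_hom x y)).
rewrite -(mod_piE (W (sq y) (sq x))) mod_pi0 -[mod_pi _ _]/(qhom_pi _).
by rewrite /qhom_pi mod_piZ.
Qed.

Lemma qgen_comp lam mu nu :
  qcomp (qgen mu nu) (qgen lam mu) = gmon (val (st nu)) (val (st mu)) (val (st lam)) *: qgen lam nu.
Proof.
have [x <-] := seq_of_state_surj nu; have [y <-] := seq_of_state_surj mu.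
have [z <-] := seq_of_state_surj lam.
rewrite !seq_of_stateK !qgenE (qcomp_pi (@W_is_ideal n k)) Xi_hom_comp.
exact: (mod_piZ (W (sq z) (sq x))).
Qed.

Lemma qgen_id lam : qid lam lam = qgen lam lam.
Proof.
have [x <-] := seq_of_state_surj lam.
rewrite /qid; case: eqP => // e; rewrite (eq_irrelevance e erefl) /= qgenE.
congr qhom_pi; apply: hom_ext; rewrite Xi_homE /=; congr (Rb_pi _ _).
by rewrite /Xi_mon big1 // => i _; rewrite subnn.
Qed.

(** Elements of [B0] with coefficients at left states only: they form the corner
    [left_one * B0 * left_one], by [left_cut]. *)
Definition expand c : B0 n k := \sum_x \sum_y c x y *: f (val x) (val y).

Lemma B0_sumE (I : finType) (F : I -> B0 n k) (u w : V) :
  (\sum_i F i) u w = \sum_i F i u w.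
Proof. exact: (big_morph (fun a : B0 n k => a u w)). Qed.

Lemma expand_coef c (u w : V) :
  expand c u w = \sum_x \sum_y c x y * ((u == val x) && (w == val y))%:R.
Proof. by rewrite /expand B0_sumE; apply: eq_bigr => x _; rewrite B0_sumE. Qed.

Lemma expandE c x y : expand c (val x) (val y) = c x y.
Proof.
rewrite expand_coef (bigD1 x) //= [X in _ + X]big1 => [|z zx].
  rewrite addr0 (bigD1 y) //= [X in _ + X]big1 => [|z zy].
    by rewrite addr0 !eqxx mulr1.
  by rewrite !val_eqE [y == z]eq_sym (negPf zy) andbF mulr0.
by rewrite big1 // => w _; rewrite !val_eqE [x == z]eq_sym (negPf zx) mulr0.
Qed.

Lemma expand_notl c (u w : V) : ord_max \in val u -> expand c u w = 0.
Proof.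
move=> ul; rewrite expand_coef big1 // => x _; rewrite big1 // => y _.
case: eqP => [E|_]; last by rewrite mulr0.
by move: ul; rewrite E (negPf (left_state x)).
Qed.

Lemma expand_notr c (u w : V) : ord_max \in val w -> expand c u w = 0.
Proof.
move=> wl; rewrite expand_coef big1 // => x _; rewrite big1 // => y _.
case: (w =P _) => [E|_]; last by rewrite andbF mulr0.
by move: wl; rewrite E (negPf (left_state y)).
Qed.

Definition expandBl c : Bl n k := \sum_x \sum_y Defs.scalar (c x y) * fl x y.

Lemma piB_sum (I : finType) (F : I -> B0 n k) : piB (\sum_i F i) = \sum_i piB (F i).
Proof.
apply: (big_morph (id1 := 0) _ (alg_piD N)).
by apply: (addrI (piB 0)); rewrite -alg_piD !addr0.
Qed.

Lemma piB_scale p (a : B0 n k) : Defs.scalar p * piB a = piB (p *: a).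
Proof. by rewrite -B0_scalarl alg_piM. Qed.

Lemma val_scalar_fl p x y : val (Defs.scalar p * fl x y) = piB (p *: f (val x) (val y)).
Proof.
rewrite -piB_scale /= -mulrA; congr (_ * _).
by rewrite /fl /= left_suml //; apply: left_state.
Qed.

Lemma val_expandBl c : val (expandBl c) = piB (expand c).
Proof.
rewrite /expandBl raddf_sum piB_sum; apply: eq_bigr => x _.
rewrite raddf_sum piB_sum; apply: eq_bigr => y _; exact: val_scalar_fl.
Qed.

Lemma sum_left (M : nmodType) (F : V -> M) :
  \sum_(x : V | ord_max \notin val x) F x = \sum_(x : Vl) F (val x).
Proof.
rewrite (reindex_omap (val : Vl -> V) insub) => [|x xl]; last by rewrite insubT.
by apply: eq_bigl => x; rewrite valK eqxx left_state.
Qed.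

Definition left_one : B0 n k := expand (fun x y => (x == y)%:R).

Lemma left_sumE : left_sum n k = piB left_one.
Proof.
rewrite /left_sum sum_left /left_one /expand piB_sum; apply: eq_bigr => x _.
rewrite (bigD1 x) //= eqxx scale1r big1 ?addr0 // => y yx.
by rewrite eq_sym (negPf yx) scale0r.
Qed.

Lemma left_oneE (u w : V) : left_one u w = ((u == w) && (ord_max \notin val u))%:R.
Proof.
have [ul|ul] := boolP (ord_max \in val u); first by rewrite andbF /left_one expand_notl.
have [wl|wl] := boolP (ord_max \in val w).
  by rewrite /left_one expand_notr //; case: eqP => // E; rewrite E wl in ul.
rewrite andbT; pose x : Vl := Sub u ul; pose y : Vl := Sub w wl.
exact: (expandE (fun x y => (x == y)%:R) x y).
Qed.

Lemma left_cut (a : B0 n k) :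
  left_one * a * left_one = expand (fun x y => a (val x) (val y)).
Proof.
apply: B0_ext => u w.
have cutE : (left_one * a * left_one) u w =
    (ord_max \notin val u)%:R * a u w * (ord_max \notin val w)%:R.
  rewrite B0_mulE (bigD1 w) //= big1 => [|w' ne]; last first.
    by rewrite left_oneE (negPf ne) !mulr0.
  rewrite addr0 gmonzz mul1r left_oneE eqxx; congr (_ * _).
  rewrite B0_mulE (bigD1 u) //= big1 => [|u' ne]; last first.
    by rewrite left_oneE eq_sym (negPf ne) mul0r mulr0.
  by rewrite addr0 gmonxx mul1r left_oneE eqxx.
rewrite cutE.
have [ul|ul] := boolP (ord_max \in val u); first by rewrite !mul0r expand_notl.
have [wl|wl] := boolP (ord_max \in val w); first by rewrite mulr0 expand_notr.
rewrite mul1r mulr1; pose x : Vl := Sub u ul; pose y : Vl := Sub w wl.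
exact: esym (expandE (fun x y => a (val x) (val y)) x y).
Qed.

Lemma Bl_expand (b : Bl n k) : exists c, b = expandBl c.
Proof.
exists (fun x y => (repr (val b) : B0 n k) (val x) (val y)); apply: val_inj.
rewrite val_expandBl -left_cut !alg_piM -left_sumE.
have -> : piB (repr (val b)) = val b by apply: alg_reprK.
rewrite -[LHS]/(val b) -[RHS]/(idem (left_idem n k) * val b * idem (left_idem n k)).
by rewrite corner_idl corner_idr.
Qed.

(** [Xi] before passing to the quotient. It is multiplicative only if the left
    factor is in the corner ([Xi0_mul]), as it ignores the coefficients at states
    that are not left. *)
Definition Xi0 (a : B0 n k) : A := fun lam mu => a (val (st mu)) (val (st lam)) *: qgen lam mu.

Lemma Xi0_eq0 (a : B0 n k) :
  Xi0 a = 0 <-> forall x y, hom_ideal (val x) (val y) (a (val x) (val y)).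
Proof.
split=> [a0 x y|aI].
  have := congr1 (fun t : A => t (sq y) (sq x)) a0.
  by rewrite /Xi0 !seq_of_stateK => /qgen_ker; rewrite !seq_of_stateK.
by apply: sartori_ext => lam mu; apply/qgen_ker/aI.
Qed.

Lemma Xi0B (a a' : B0 n k) : Xi0 (a - a') = Xi0 a - Xi0 a'.
Proof. by apply: sartori_ext => lam mu; apply: scalerBl. Qed.

Lemma sartori_mulE (s t : A) lam nu :
  (s * t) lam nu = \sum_(mu : D) qcomp (s mu nu) (t lam mu).
Proof. by []. Qed.

Lemma sartori_scalarE p lam mu : (Defs.scalar p : A) lam mu = p *: qid lam mu.
Proof. by []. Qed.

Lemma Xi0_mul c (a : B0 n k) : Xi0 (expand c * a) = Xi0 (expand c) * Xi0 a.
Proof.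
apply: sartori_ext => lam nu; rewrite sartori_mulE /Xi0 B0_mulE.
rewrite (bigID (fun u : V => ord_max \in val u)) /= big1 => [|u ul]; last first.
  by rewrite expand_notr // mul0r mulr0.
rewrite add0r sum_left scaler_suml.
rewrite (reindex sq) /=; last by exists st => x _; rewrite ?seq_of_stateK ?state_of_seqK.
apply: eq_bigr => x _; rewrite seq_of_stateK (qcompZl (@W_is_ideal n k)).
rewrite (qcompZr (@W_is_ideal n k)) qgen_comp seq_of_stateK !scalerA.
by congr (_ *: _); rewrite mulrC.
Qed.

Definition Xi (b : Bl n k) : A := Xi0 (repr (val b)).

Lemma XiE (b : Bl n k) (a : B0 n k) : val b = piB a -> Xi b = Xi0 a.
Proof.
move=> ba; apply/eqP; rewrite -subr_eq0 /Xi -Xi0B; apply/eqP/Xi0_eq0 => x y.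
apply/level_hom_ideal/rel_ideal_level/alg_piE; rewrite -ba; exact: alg_reprK.
Qed.

Lemma Xi_expandBl c : Xi (expandBl c) = Xi0 (expand c).
Proof. exact/XiE/val_expandBl. Qed.

Lemma Xi0_left_one : Xi0 left_one = 1.
Proof.
apply: sartori_ext => lam mu; rewrite /Xi0 left_oneE left_state andbT.
have [->|ne] := eqVneq lam mu; first by rewrite eqxx scale1r -qgen_id.
rewrite [RHS](qid0 ne) (_ : (_ == _) = false) ?scale0r //.
rewrite val_eqE; apply: contraNF ne => /eqP/(congr1 sq).
by rewrite !state_of_seqK => ->.
Qed.

Lemma Xi_morphism : alg_morphism Xi.
Proof.
split.
- move=> b b'; have [c ->] := Bl_expand b; have [c' ->] := Bl_expand b'.
  rewrite !Xi_expandBl -Xi0B; apply: XiE.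
  by rewrite raddfB /= !val_expandBl -alg_piN -alg_piD.
- split; first by rewrite -Xi0_left_one; apply/XiE/left_sumE.
  move=> b b'; have [c ->] := Bl_expand b; have [c' ->] := Bl_expand b'.
  rewrite !Xi_expandBl -Xi0_mul; apply: XiE.
  by rewrite alg_piM -!val_expandBl.
move=> p; rewrite (XiE (a := p *: left_one)); last by rewrite -piB_scale -left_sumE.
apply: sartori_ext => lam mu; rewrite /Xi0 B0_scaleE -scalerA.
by rewrite [_ *: qgen lam mu](congr1 (fun t : A => t lam mu) Xi0_left_one).
Qed.

Lemma Xi_spec_holds : Xi_spec Xi.
Proof.
move=> x y /=; have XiE0 := @XiE (fl x y) (f (val x) (val y)) erefl.
case: ifP => far.
  rewrite XiE0; apply/Xi0_eq0 => u w; rewrite /f; case: andP => [[/eqP-> /eqP->]|_].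
    by apply/level_hom_ideal/too_far_level.
  exact: gen0.
exists (Xi_hom x y); first exact: Xi_homE.
rewrite XiE0 /Xi0 /f; split; first by rewrite !seq_of_stateK !eqxx scale1r qgenE.
move=> lam mu ne; case: andP => [[/eqP xE /eqP yE]|_]; last exact: scale0r.
case/eqP: ne; congr pair; [move: yE | move: xE] => /val_inj/(congr1 sq).
  by rewrite state_of_seqK.
by rewrite state_of_seqK.
Qed.

Lemma Xi_surjective (t : A) : exists b, Xi b = t.
Proof.
pose c x y := projT1 (cid (qgen_span (t (sq y) (sq x)))).
exists (expandBl c); rewrite Xi_expandBl; apply: sartori_ext => lam mu.
rewrite /Xi0 expandE /c; case: cid => /= r; rewrite !state_of_seqK => ->.
by [].
Qed.

(** Modulo the elementary symmetric polynomials, the coefficients of an element of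
    the kernel are combinations of the [level_mon], which kill the [f_{x,y}]. *)
Lemma Xi_kernel (b : Bl n k) :
  Xi b = 0 <-> b \in (ideal_gen (@Bl_rel n k) : {pred Bl n k}).
Proof.
have [XiB [Xi1 XiM] XiZ] := Xi_morphism.
split=> [|/asboolP bI]; last first.
  have kerP : ideal_closed (fun b : Bl n k => `[<Xi b = 0>]).
    split; first split.
    - by apply/asboolP; rewrite -(subrr (0 : Bl n k)) XiB subrr.
    - by move=> d d' /asboolP d0 /asboolP d0'; apply/asboolP; rewrite XiB d0 d0' subrr.
    by move=> d d' /asboolP d0'; split; apply/asboolP; rewrite XiM d0' ?mulr0 ?mul0r.
  suff rel_ker d : Bl_rel d -> d \in (Ideal kerP : {pred Bl n k}).
    by have /asboolP := bI (Ideal kerP) rel_ker.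
  case=> j jk; apply/asboolP.
  rewrite XiZ; apply: sartori_ext => lam mu; rewrite sartori_scalarE.
  have [->|ne] := eqVneq lam mu; last by rewrite [qid _ _](qid0 ne) scaler0.
  rewrite qgen_id; apply/qgen_ker/gen_mem; right; by exists j.
have [c ->] := Bl_expand b; rewrite Xi_expandBl => /Xi0_eq0 cI.
apply: rpred_sum => x _; apply: rpred_sum => y _.
have := cI x y; rewrite expandE; move: (c x y).
have idP := idealP (ideal_gen (@Bl_rel n k)).
apply: gen_ind => [|s [[h hk ->]|[d dk ->]]].
- split=> [|p q pI qI|p q qI].
  + by rewrite rmorph0 mul0r; apply: rpred0.
  + by rewrite rmorphD mulrDl; apply: rpredD.
  by rewrite rmorphM -mulrA; have [] := idP.2 (Defs.scalar p) _ qI.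
- suff -> : Defs.scalar (level_mon (val x) (val y) h) * fl x y = 0 by apply: rpred0.
  apply: val_inj; rewrite val_scalar_fl.
  rewrite -[RHS](_ : piB 0 = 0); first by apply/alg_piE; rewrite subr0; apply: level_mon_relation.
  by apply: (addrI (piB 0)); rewrite -alg_piD !addr0.
have symI : Defs.scalar (mesym n int d) \in (ideal_gen (@Bl_rel n k) : {pred Bl n k}).
  by apply/asboolP=> I; apply; apply: Bl_rel_sym.
by have [] := idP.2 (fl x y) _ symI.
Qed.

End Isomorphism.

Theorem theorem7p6 (n k : nat) (k_le_n : (k <= n)%N) :
  exists (W_id : W_ideal n k) (Xi : Bl n k -> sartori W_id),
    [/\ alg_morphism Xi, Xi_spec Xi &
      exists Xibar : Bbar n k -> sartori W_id,
        [/\ alg_morphism Xibar,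
            forall b : Bl n k, Xibar (Bbar_pi b) = Xi b
          & bijective Xibar]].
Proof.
exists (@W_is_ideal n k), (@Xi n k); split; [exact: Xi_morphism | exact: Xi_spec_holds |].
exact: quotient_isomorphism (@Xi_morphism n k) (@Xi_kernel n k) (@Xi_surjective n k).
Qed.
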